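(* There exist constants $C>0$ and $\omega>0$ such that for all $(\underline{u}^0,\underline{u}^1)\in\mathcal{H}$ the solution $\underline{u}$ of system $(P)$ with initial datum $(\underline{u}^0,\underline{u}^1)$ satisfies $$E(t)\le C\,e^{-\omega t}\,\|(\underline{u}^0,\underline{u}^1)\|_{\mathcal{H}}^2,\qquad \forall\, t>0.$$
   Context: Let $N\ge 1$ be an integer and $\rho_0,\dots,\rho_{N-1}>0$ constants. System $(P)$ is, for unknowns $u_j(t,x)$, $x\in(j,j+1)$, $t\in(0,\infty)$, $j=0,\dots,N-1$: $$\begin{cases}\partial_t^2u_j-\rho_j\partial_x^2u_j=0 \text{ on } (0,\infty)\times(j,j+1), & j=0,\dots,N-1,\\ \rho_0\partial_xu_0(t,0)=\partial_tu_0(t,0),\quad u_{N-1}(t,N)=0,\\ u_{j-1}(t,j)=u_j(t,j), & j=1,\dots,N-1,\\ -\rho_{j-1}\partial_xu_{j-1}(t,j)+\rho_j\partial_xu_j(t,j)=0, & j=1,\dots,N-1,\\ u_j(0,x)=u_j^0(x),\ \partial_tu_j(0,x)=u_j^1(x), & j=0,\dots,N-1.\end{cases}$$ All functions are complex valued. Let $$V=\Big\{\underline{u}=(u_0,\dots,u_{N-1})\in\prod_{j=0}^{N-1}H^1(j,j+1):\ u_{N-1}(N)=0,\ u_{j-1}(j)=u_j(j),\ j=1,\dots,N-1\Big\}$$ and $\mathcal{H}=V\times\prod_{j=0}^{N-1}L^2(j,j+1)$, with norm $\|(\underline{u},\underline{v})\|_{\mathcal{H}}^2=\sum_{j=0}^{N-1}\int_j^{j+1}(|v_j|^2+\rho_j|\partial_xu_j|^2)\,dx$.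 Let $\mathcal{A}(\underline{u},\underline{v})=(\underline{v},(\rho_j\partial_x^2u_j)_{0\le j\le N-1})$ with domain $$\mathcal{D}(\mathcal{A})=\Big\{(\underline{u},\underline{v})\in\Big(V\cap\prod_{j=0}^{N-1}H^2(j,j+1)\Big)\times V:\ \rho_0\partial_xu_0(0)=v_0(0),\ \rho_{j-1}\partial_xu_{j-1}(j)=\rho_j\partial_xu_j(j),\ 1\le j\le N-1\Big\}.$$ The operator $\mathcal{A}$ generates a $C_0$-semigroup of contractions on $\mathcal{H}$; the solution of $(P)$ for initial datum $U_0=(\underline{u}^0,\underline{u}^1)\in\mathcal{H}$ is the (mild) solution $U=(\underline{u},\partial_t\underline{u})\in C([0,\infty),\mathcal{H})$ of $U'=\mathcal{A}U$, $U(0)=U_0$. The energy is $$E(t)=\frac12\sum_{j=0}^{N-1}\int_j^{j+1}\left(|\partial_tu_j(t,x)|^2+\rho_j|\partial_xu_j(t,x)|^2\right)dx.$$ *)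

(* Defs.v *)
From HB Require Import structures.
From mathcomp Require Import all_boot all_order all_algebra.
From mathcomp Require Import complex.
From mathcomp Require Import all_classical all_reals all_analysis.

Set Implicit Arguments.
Unset Strict Implicit.
Unset Printing Implicit Defensive.

Import Order.TTheory GRing.Theory Num.Theory.
Import numFieldNormedType.Exports.

Local Open Scope classical_set_scope.
Local Open Scope ring_scope.
Local Open Scope complex_scope.

(* Elements of L^2, H^1 and H^2 are given by Borel representatives R -> R[i],
   identified when they are equal a.e. on ]a, b[. *)

Section Sobolev.
Context {R : realType}.
Implicit Types (a b : R) (f u g : R -> R[i]).

Local Notation mu := (@lebesgue_measure R).

Definition sqnormc (z : R[i]) : R := Normc.normc z ^+ 2.

Definition cintegral a b f : R[i] :=
  (\int[mu]_(x in `]a, b[) complex.Re (f x)) +i* (\int[mu]_(x in `]a, b[) complex.Im (f x)).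

Definition L2 a b f : Prop :=
  [/\ measurable_fun `]a, b[ (fun x => complex.Re (f x)),
      measurable_fun `]a, b[ (fun x => complex.Im (f x)) &
      mu.-integrable `]a, b[ (fun x => (sqnormc (f x))%:E)].

Definition aeq a b f g : Prop := ae_eq mu `]a, b[%classic f g.

(* C^1_c(]a, b[). Testing against real functions is enough, the pairing being
   C-linear in the test function; testing against C^1_c instead of C^oo_c
   defines the same weak derivatives, by mollification. *)
Definition test_function a b (phi : R -> R) : Prop :=
  [/\ forall x, derivable phi x 1,
      continuous (derive1 phi),
      compact (closure [set x | phi x != 0]) &
      closure [set x | phi x != 0] `<=` `]a, b[].

Definition is_weak_derivative a b u g : Prop :=
  forall phi, test_function a b phi ->
    cintegral a b (fun x => u x * (derive1 phi x)%:C) =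
    - cintegral a b (fun x => g x * (phi x)%:C).

(* The L^2 weak derivative, unique up to a.e. equality when it exists (and
   the junk value 0 when it does not). *)
Definition wderiv a b u : R -> R[i] :=
  xget (fun=> 0) [set g | L2 a b g /\ is_weak_derivative a b u g].

Definition H1 a b u : Prop :=
  L2 a b u /\ exists g, L2 a b g /\ is_weak_derivative a b u g.

Definition H2 a b u : Prop := H1 a b u /\ H1 a b (wderiv a b u).

(* Point values at x in [a, b] of (the class of) a function of H^1(a, b) are
   those of its continuous representative, which is unique on [a, b].
   R[i]^o is R[i] with its norm topology. *)
Definition trace a b u (x : R) : R[i] :=
  xget u [set w : R -> R[i] |
    {within `[a, b], continuous (w : R -> R[i]^o)} /\ aeq a b u w] x.

End Sobolev.

Definition family (R : realType) (N : nat) : Type := 'I_N -> R -> R[i].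
Definition state (R : realType) (N : nat) : Type := (family R N * family R N)%type.

Section System.
Context {R : realType} {N : nat} (rho : 'I_N -> R).

Implicit Types (u v : family R N) (W : state R N) (j : 'I_N).

Local Notation mu := (@lebesgue_measure R).

(* The j-th component lives on ]j, j + 1[. *)
Definition lend j : R := j%:R.
Definition rend j : R := j.+1%:R.

Definition dx u : family R N :=
  fun j => wderiv (lend j) (rend j) (u j).

(* Point values of a family at the end points of the j-th interval. *)
Definition ltrace u j : R[i] := trace (lend j) (rend j) (u j) (lend j).
Definition rtrace u j : R[i] := trace (lend j) (rend j) (u j) (rend j).

Definition inV u : Prop :=
  [/\ forall j : 'I_N, H1 (lend j) (rend j) (u j),
      forall j : 'I_N, j.+1 = N -> rtrace u j = 0 &
      forall i j : 'I_N, j = i.+1 :> nat -> rtrace u i = ltrace u j].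

Definition inH W : Prop :=
  inV W.1 /\ forall j : 'I_N, L2 (lend j) (rend j) (W.2 j).

Definition normH W : R :=
  Num.sqrt (\sum_(j < N) \int[mu]_(x in `]lend j, rend j[)
    (sqnormc (W.2 j x) + rho j * sqnormc (dx W.1 j x))).

Definition eqH W W' : Prop :=
  forall j : 'I_N, aeq (lend j) (rend j) (W.1 j) (W'.1 j) /\
            aeq (lend j) (rend j) (W.2 j) (W'.2 j).

Definition opA W : state R N :=
  (W.2, fun j x => (rho j)%:C * dx (dx W.1) j x).

Definition inDA W : Prop :=
  [/\ inV W.1 /\ (forall j : 'I_N, H2 (lend j) (rend j) (W.1 j)),
      inV W.2,
      forall j : 'I_N, j = 0%N :> nat ->
        (rho j)%:C * ltrace (dx W.1) j = ltrace W.2 j &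
      forall i j : 'I_N, j = i.+1 :> nat ->
        (rho i)%:C * rtrace (dx W.1) i = (rho j)%:C * ltrace (dx W.1) j].

(* U is in C([0, +oo), H). *)
Definition continuousH (U : R -> state R N) : Prop :=
  (forall t, 0 <= t -> inH (U t)) /\
  (forall t, 0 <= t ->
    normH (U s - U t) @[s --> within [set s | 0 <= s] (nbhs t)] --> (0 : R)).

(* W is the Riemann integral of U over [0, t], in the norm of H: s_0, ..., s_n
   is a subdivision of [0, t] with tags xi_k. *)
Definition is_integralH (U : R -> state R N) (t : R) W : Prop :=
  forall e : R, 0 < e -> exists2 d : R, 0 < d &
    forall (n : nat) (s xi : nat -> R),
      s 0%N = 0 -> s n = t ->
      (forall k, (k < n)%N -> s k <= xi k <= s k.+1 /\ s k.+1 - s k < d) ->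
      normH (\sum_(k < n) (s k.+1 - s k)%:C *: U (xi k) - W) < e.

(* Mild solution of U' = A U, U(0) = U0: U is continuous and, for all t >= 0,
   the integral W of U over [0, t] is in D(A) and U(t) = U0 + A W. *)
Definition mild_solution (U0 : state R N) (U : R -> state R N) : Prop :=
  [/\ continuousH U, eqH (U 0) U0 &
      forall t, 0 <= t -> exists W,
        [/\ is_integralH U t W, inDA W & eqH (U t) (U0 + opA W)]].

(* For U = (u, d_t u) the second component of U is d_t u. *)
Definition energy W : R :=
  2^-1 * \sum_(j < N) \int[mu]_(x in `]lend j, rend j[)
    (sqnormc (W.2 j x) + rho j * sqnormc (dx W.1 j x)).

End System.

(* Main.v *)
(** The multiplier method.  Along a classical solution, put [v = u_t], [p = u_x]
    and consider on the j-th interval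
      [int |v|^2 + rho_j |p|^2 - 2 K_j (N - x) Re (v conj p)].
    Integration by parts shows that its derivative is [-K_j] times the energy of
    the interval plus boundary terms.  At [x = N] these vanish; at an
    interface [v] and the flux [rho_j p] are continuous, so they have the good
    sign as soon as [K_j] decreases fast enough with [j]; at [x = 0] they are
    absorbed by the damping [-2 |v(0)|^2] when the [K_j] are small.  For small
    [K_j] the functional is moreover equivalent to the energy, which
    gives exponential decay of classical solutions.

    A mild solution [U] is reduced to this case through the increments
    [W (t + h) - W t] of [W t = int_0^t U]: they lie in D(A), solve the equation
    in the classical sense, and [(W (t + h) - W t) / h] tends to [U t].

    Functions of H^1 are replaced by primitives of integrable functions: testing
    a weak derivative against smoothed indicators of an interval with Lebesgue end points [x < y]
    gives [u y - u x = int_x^y u'].  The product rule for such primitives is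
    Fubini's theorem on a triangle. *)

Require Import Defs.
From HB Require Import structures.
From mathcomp Require Import all_boot all_order all_algebra.
From mathcomp Require Import complex.
From mathcomp Require Import all_classical all_reals all_analysis.
From mathcomp Require Import measurable_realfun ring lra.

Import Order.TTheory GRing.Theory Num.Theory.
Import numFieldNormedType.Exports.

Local Open Scope classical_set_scope.
Local Open Scope ring_scope.

(** * A C^1 step function and its test functions *)

(** A mild solution need not lie in D(A), so the Lyapunov form cannot be differentiated along [U]
    and the boundary terms have no meaning for it. The integral [W] does lie in D(A), but it solves
    the inhomogeneous equation [W' = A W + U0]; only in differences of [W] does [U0] cancel. Such a
    difference [y] is differentiable in time merely in the norm of H, which suffices because the
    form [B] is bilinear: the derivative of [B y y] is [2 * B y (A y)], and the integration by parts
    concerns the space variable only.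

    The weights [K_j] cannot in general be equal. At an interface the flux [rho p] is continuous,
    hence the density [rho |p|^2 = |rho p|^2 / rho] jumps up where [rho] drops, and [K_j] must
    decrease enough to compensate both this jump and none in [|v|^2]. At [x = N] the factor [N - x]
    removes the unknown value of [p], while [v = 0] removes the flux term. The smallest weight then
    fixes the decay rate. *)

Section Step.
Context {R : realType}.
Implicit Types z x y c : R.

Definition sqpos z : R := Num.max 0 z ^+ 2.

Lemma sqpos_taylor z h :
  `|sqpos (z + h) - sqpos z - 2 * Num.max 0 z * h| <= h ^+ 2.
Proof.
have h2 := sqr_ge0 h.
rewrite /sqpos ler_norml; case: (lerP 0 z) => hz; case: (lerP 0 (z + h)) => hh;
  rewrite ?max_l ?max_r ?(ltW hz) ?(ltW hh) //; apply/andP; split; nra.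
Qed.

Lemma is_derive_sqpos z : is_derive z 1 sqpos (2 * Num.max 0 z).
Proof.
have H : h^-1 *: ((sqpos \o shift z) (h *: 1) - sqpos z) @[h --> 0^']
    --> (2 * Num.max 0 z : R).
  apply/cvgrPdist_le => e e0; near=> h.
  have h0 : h != 0 by near: h; exact: nbhs_dnbhs_neq.
  have hn : 0 < `|h| by rewrite normr_gt0.
  rewrite /= -(ler_pM2l hn) -normrM mulrBr. rewrite /GRing.scale /= mulr1 mulVKf //.
  rewrite distrC (addrC h z) [h * _]mulrC.
  apply: (le_trans (sqpos_taylor z h)); rewrite -real_normK ?num_real// expr2.
  rewrite ler_wpM2l //; near: h.
  by apply: dnbhs0_le.
apply: DeriveDef; first by apply/cvg_ex; eexists; exact: H.
by apply/cvg_lim => //; exact: H.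
Unshelve. all: by end_near. Qed.

(* Built from [max 0 z ^+ 2], which is C^1, so that no gluing is needed; equal to
   0 for [z <= 0] and to 1 for [z >= 1]. *)
Definition step z : R := 1 - sqpos (1 - sqpos z).
Definition dstep z : R := 4 * (Num.max 0 (1 - sqpos z) * Num.max 0 z).

Lemma is_derive_step z : is_derive z 1 step (dstep z).
Proof.
have h1 := is_derive_sqpos z.
have h2 : is_derive z 1 (fun t => 1 - sqpos t) (0 - 2 * Num.max 0 z) by exact: is_deriveB.
have h3 := is_derive_sqpos (1 - sqpos z).
have h4 : is_derive z 1 (sqpos \o (fun t => 1 - sqpos t))
    (2 * Num.max 0 (1 - sqpos z) * (0 - 2 * Num.max 0 z)).
  exact: (@is_derive1_comp _ sqpos (fun t => 1 - sqpos t)).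
have h5 := is_deriveB (is_derive_cst (1:R) z 1) h4.
by apply: (is_derive_eq h5); rewrite /dstep; ring.
Qed.

Lemma max0_continuous : continuous (fun z : R => Num.max 0 z).
Proof. by move=> z; apply: continuous_max; [exact: cvg_cst|exact: cvg_id]. Qed.

Lemma sqpos_continuous : continuous sqpos.
Proof.
by move=> z; apply: (@continuous_comp _ _ _ (fun z : R => Num.max 0 z) (fun z => z ^+ 2));
  [exact: max0_continuous|exact: exprn_continuous].
Qed.

Lemma dstep_continuous : continuous dstep.
Proof.
move=> z; rewrite /dstep; apply: cvgMr; apply: cvgM; last exact: max0_continuous.
apply: (@continuous_comp _ _ _ (fun z : R => 1 - sqpos z) (fun z : R => Num.max 0 z));
  last exact: max0_continuous.
by apply: cvgB; [exact: cvg_cst|exact: sqpos_continuous].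
Qed.

Lemma step_le0 z : z <= 0 -> step z = 0.
Proof. by move=> z0; rewrite /step /sqpos (max_l z0) expr0n subr0 max_r // expr1n subrr. Qed.

Lemma step_ge1 z : 1 <= z -> step z = 1.
Proof. move=> z1; rewrite /step /sqpos [Num.max 0 z]max_r; last lra. by rewrite max_l; nra. Qed.

Lemma step_ge0 z : 0 <= step z.
Proof.
rewrite /step /sqpos; case: (lerP 0 z) => hz; last by rewrite expr0n subr0 max_r // expr1n subrr.
by case: (lerP 0 (1 - z^+2)) => h; nra.
Qed.

Lemma step_le1 z : step z <= 1.
Proof. by rewrite /step gerBl sqr_ge0. Qed.

Lemma dstep_le0 z : z <= 0 -> dstep z = 0.
Proof. by move=> z0; rewrite /dstep [Num.max 0 z]max_l // !mulr0. Qed.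

Lemma dstep_ge1 z : 1 <= z -> dstep z = 0.
Proof.
move=> z1; rewrite /dstep [Num.max 0 (_ - _)]max_l ?mul0r ?mulr0 //.
by rewrite /sqpos max_r; nra.
Qed.

Lemma dstep_bound z : `|dstep z| <= 4.
Proof.
have [z0|z0] := lerP z 0; first by rewrite dstep_le0 // normr0.
have [z1|z1] := lerP 1 z; first by rewrite dstep_ge1 // normr0.
rewrite /dstep /sqpos ![Num.max 0 z]max_r ?(ltW z0)//.
rewrite max_r; last nra.
rewrite ger0_norm; nra.
Qed.

(** For [x <= y] it rises on [[x, x + c^-1]] and falls on [[y, y + c^-1]]. Its derivative is a
    difference of two translates of one kernel, so each end point can be treated separately, and the
    support exceeds [[x, y]] only to the right. *)
Definition bump c x y z : R := step (c * (z - x)) - step (c * (z - y)).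
Definition dbump c x y z : R := c * dstep (c * (z - x)) - c * dstep (c * (z - y)).

Lemma is_derive_stepM c x z :
  is_derive z 1 (fun t => step (c * (t - x))) (c * dstep (c * (z - x))).
Proof.
have h1 : is_derive z 1 (fun t => c * (t - x)) (c * (1 - 0)).
  have h : is_derive z 1 (fun t : R => t - x) (1 - 0) by exact: is_deriveB.
  exact: is_deriveZ.
have := @is_derive1_comp _ step (fun t => c * (t - x)) z _ _ (is_derive_step (c * (z - x))) h1.
by move=> H; apply: (is_derive_eq H); rewrite subr0 mulr1 mulrC.
Qed.

Lemma is_derive_bump c x y z : is_derive z 1 (bump c x y) (dbump c x y z).
Proof. by apply: is_deriveB; exact: is_derive_stepM. Qed.

Lemma scale_dstep_continuous c x : continuous (fun z => c * dstep (c * (z - x))).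
Proof.
move=> z; apply: cvgMr.
apply: (@continuous_comp _ _ _ (fun z : R => c * (z - x)) dstep); last exact: dstep_continuous.
by apply: cvgMr; apply: cvgB; [exact: cvg_id|exact: cvg_cst].
Qed.

Lemma bump_test_function a b c x y : 0 < c -> a < x -> x <= y -> y + c^-1 < b ->
  test_function a b (bump c x y).
Proof.
move=> c0 ax xy yb.
have sub : closure [set z | bump c x y z != 0] `<=` `[x, y + c^-1].
  rewrite ((closure_id _).1 (@itv_closed _ R x (y + c^-1))).
  apply: closure_subset => z /= h; rewrite in_itv /=; apply/andP; split.
    rewrite leNgt; apply: contra h => zx; rewrite /bump !step_le0 ?subrr //; nra.
  rewrite leNgt; apply: contra h => zx; rewrite /bump !step_ge1 ?subrr //.
    by rewrite -ler_pdivrMl // mulr1; lra.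
  by rewrite -ler_pdivrMl // mulr1; lra.
split.
- by move=> z; case: (is_derive_bump c x y z).
- rewrite (_ : derive1 _ = dbump c x y).
    by move=> z; apply: cvgB; exact: scale_dstep_continuous.
  by apply/funext => z; rewrite derive1E; case: (is_derive_bump c x y z).
- by apply: (subclosed_compact _ (@segment_compact _ x (y + c^-1))) => //; exact: closed_closure.
- by move=> z /sub; rewrite /= !in_itv /=; lra.
Qed.

Lemma derive1_bump c x y z : derive1 (bump c x y) z = dbump c x y z.
Proof. by rewrite derive1E; case: (is_derive_bump c x y z). Qed.

End Step.

(** * Weak derivatives and primitives *)

Section Weak.
Context {R : realType}.
Local Notation mu := (@lebesgue_measure R).
Implicit Types (u g f : R -> R) (a b c x y z : R).

Lemma step_scale_cvg x z :
  step (n.+1%:R * (z - x)) @[n --> \oo] --> (\1_(`]x, +oo[%classic) z : R).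
Proof.
rewrite indicE; case: (ltrP x z) => xz.
  rewrite mem_set /= ?in_itv /= ?xz //.
  apply: cvg_near_cst; near=> n; apply/step_ge1.
  have zx : 0 < z - x by rewrite subr_gt0.
  rewrite -ler_pdivrMr // mul1r; apply: le_trans (_ : n%:R <= _); last by rewrite ler_nat.
  near: n; exact: nbhs_infty_ger.
rewrite memNset /= ?in_itv /= ?andbT; last by apply/negP; rewrite -leNgt.
apply: cvg_near_cst; near=> n; apply: step_le0; rewrite mulr_ge0_le0 ?subr_le0 //.
Unshelve. all: by end_near. Qed.

Lemma intg_mul_bounded A f (k : R -> R) M : measurable A -> mu.-integrable A (EFin \o f) ->
  measurable_fun A k -> (forall z, A z -> `|k z| <= M) ->
  mu.-integrable A (EFin \o (fun z => f z * k z)).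
Proof.
move=> mA If mk kM; apply: (integrableMl mA If mk).
exists M; split; first exact: num_real.
by move=> N MN z Az; apply: le_trans (kM z Az) (ltW MN).
Qed.

Lemma ae_imp (P Q : R -> Prop) : (forall x, P x -> Q x) ->
  {ae mu, forall x, P x} -> {ae mu, forall x, Q x}.
Proof. by move=> PQ; apply: (@filterS _ _ (ae_filter_ringOfSetsType mu)). Qed.

Lemma ae_imp2 (P Q S : R -> Prop) : (forall x, P x -> Q x -> S x) ->
  {ae mu, forall x, P x} -> {ae mu, forall x, Q x} -> {ae mu, forall x, S x}.
Proof. by move=> PQ; apply: (@filterS2 _ _ (ae_filter_ringOfSetsType mu)). Qed.

Lemma intgZ A k f : measurable A -> mu.-integrable A (EFin \o f) ->
  mu.-integrable A (EFin \o (fun z => k * f z)).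
Proof. by move=> mA If; exact: (integrableZl mA k If). Qed.

Lemma intgZr A k f : measurable A -> mu.-integrable A (EFin \o f) ->
  mu.-integrable A (EFin \o (fun z => f z * k)).
Proof. by move=> mA If; exact: (integrableZr mA k If). Qed.

Lemma intgD A f g : measurable A -> mu.-integrable A (EFin \o f) ->
  mu.-integrable A (EFin \o g) -> mu.-integrable A (EFin \o (fun z => f z + g z)).
Proof. by move=> mA If Ig; exact: (integrableD mA If Ig). Qed.

Lemma intgB A f g : measurable A -> mu.-integrable A (EFin \o f) ->
  mu.-integrable A (EFin \o g) -> mu.-integrable A (EFin \o (fun z => f z - g z)).
Proof. by move=> mA If Ig; exact: (integrableB mA If Ig). Qed.

Lemma intg_patch A f : measurable A -> mu.-integrable A (EFin \o f) ->
  mu.-integrable setT (EFin \o (f \_ A)).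
Proof. by move=> mA If; rewrite -restrict_EFin; exact: (integrable_mkcond _ mA).1. Qed.

Lemma intg_measurable A f : mu.-integrable A (EFin \o f) -> measurable_fun A f.
Proof. by case/integrableP => /measurable_EFinP. Qed.

Lemma continuous_measurable_on A (k : R -> R) : measurable A -> continuous k -> measurable_fun A k.
Proof. by move=> mA ck; apply: measurable_funTS; exact: continuous_measurable_fun. Qed.

Lemma step_scale_continuous c x : continuous (fun z => step (c * (z - x))).
Proof.
by move=> z; apply: differentiable_continuous; apply/derivable1_diffP; case: (is_derive_stepM c x z).
Qed.

Lemma step_scale_integral_cvg g x : mu.-integrable setT (EFin \o g) ->
  \int[mu]_z (g z * step (n.+1%:R * (z - x))) @[n --> \oo] --> \int[mu]_(z in `]x, +oo[) g z.
Proof.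
move=> Ig.
have st n z : `|step (n.+1%:R * (z - x))| <= 1 by rewrite ger0_norm ?step_ge0 ?step_le1.
have mg : measurable_fun setT g by apply/measurable_EFinP; case/integrableP: Ig.
have [||||| _ _ H] := @dominated_convergence _ _ R mu setT measurableT
  (fun n z => (g z * step (n.+1%:R * (z - x)))%:E)
  (fun z => (g z * \1_(`]x, +oo[%classic) z)%:E) (fun z => `|g z|%:E).
- move=> n; apply/measurable_EFinP; apply: measurable_funM => //.
  by apply: continuous_measurable_on => //; exact: step_scale_continuous.
- by apply/measurable_EFinP; apply: measurable_funM => //; exact: measurable_indic.
- apply: aeW => z _; apply: cvg_EFin; first by near=> n.
  apply: cvgM; first exact: cvg_cst.
  exact: step_scale_cvg.
- exact: integrable_norm.
- by apply: aeW => z n _; rewrite lee_fin normrM -[X in _ <= X]mulr1 ler_wpM2l.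
have -> : \int[mu]_(z in `]x, +oo[) g z = \int[mu]_z (g z * \1_(`]x, +oo[%classic) z).
  rewrite Rintegral_mkcond; apply: eq_Rintegral => z _.
  by rewrite patchE indicE; case: ifP => h; rewrite ?mulr1 ?mulr0.
apply: fine_cvg.
rewrite fineK; first exact: H.
apply: integrable_fin_num => //.
apply: (intg_mul_bounded setT g (\1_(`]x, +oo[%classic)) 1) => //.
by move=> z _; rewrite indicE; case: (_ \in _); rewrite ?normr1 ?normr0.
Unshelve. all: by end_near. Qed.

Lemma intg_cst A k : measurable A -> (mu A < +oo)%E -> mu.-integrable A (EFin \o cst k).
Proof.
move=> mA fA; apply: measurable_bounded_integrable => //.
exists `|k|; split; first exact: num_real.
by move=> M kM z _; exact: ltW.
Qed.

(** A one-sided approximate identity at [x]: support in [[x, x + n.+1^-1]], mass 1 and height at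
    most [4 * n.+1]. *)
Definition step_kernel n x z : R := n.+1%:R * dstep (n.+1%:R * (z - x)).

Lemma step_kernel_out n x z : ~ (`[x, x + n.+1%:R^-1]%classic z) -> step_kernel n x z = 0.
Proof.
rewrite /= in_itv /= => /negP; rewrite negb_and -!ltNge /step_kernel => /orP[h|h].
  by rewrite dstep_le0 ?mulr0 // mulr_ge0_le0 // subr_le0 ltW.
by rewrite dstep_ge1 ?mulr0 // -ler_pdivrMl ?ltr0Sn // mulr1 lerBrDl ltW.
Qed.

Lemma step_kernel_bound n x z : `|step_kernel n x z| <= 4 * n.+1%:R.
Proof. by rewrite /step_kernel normrM ger0_norm // mulrC ler_wpM2r // dstep_bound. Qed.

Lemma step_kernel_int n x : \int[mu]_(z in `[x, x + n.+1%:R^-1]) step_kernel n x z = 1.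
Proof.
have h : x < x + n.+1%:R^-1 by rewrite ltrDl invr_gt0 ltr0Sn.
have cs := @step_scale_continuous (n.+1%:R) x.
rewrite /Rintegral (@continuous_FTC2 _ _ (fun t => step (n.+1%:R * (t - x))) _ _ h) //.
- rewrite /= [x + _ - x]addrC addKr subrr mulr0 mulfV ?pnatr_eq0 //.
  by rewrite step_ge1 // step_le0 // subr0.
- by apply: continuous_subspaceT; exact: scale_dstep_continuous.
- split.
  + by move=> z _; case: (is_derive_stepM (n.+1%:R) x z).
  + by apply: cvg_at_right_filter; exact: cs.
  + by apply: cvg_at_left_filter; exact: cs.
- by move=> z _; rewrite derive1E; case: (is_derive_stepM (n.+1%:R) x z).
Qed.

Lemma step_kernel_cvg u x : mu.-integrable setT (EFin \o u) -> lebesgue_pt u x ->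
  \int[mu]_z (u z * step_kernel n x z) @[n --> \oo] --> u x.
Proof.
move=> Iu Lx.
have I n : \int[mu]_z (u z * step_kernel n x z) = \int[mu]_(z in `[x, x + n.+1%:R^-1]) (u z * step_kernel n x z).
  rewrite [RHS]Rintegral_mkcond; apply: eq_Rintegral => z _; rewrite patchE.
  by case: ifP => // /negP; rewrite inE => /step_kernel_out ->; rewrite mulr0.
have Iusub A : measurable A -> (mu A < +oo)%E -> mu.-integrable A (EFin \o (fun z => u z - u x)).
  move=> mA fA; apply: (@integrableB _ _ _ mu A mA (EFin \o u) (EFin \o cst (u x))).
    exact: integrableS Iu.
  exact: intg_cst.
apply/cvgrPdist_le => e e0.
have r0 n : 0 < 2 / n.+1%:R :> R by rewrite divr_gt0 // ltr0Sn.
have d_cvg : davg u x (2 / n.+1%:R) @[n --> \oo] --> 0%E.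
  apply: (cvge_at_rightP _ 0 0).1 Lx _ _; split => //.
  have H : (2 : R) * harmonic n @[n --> \oo] --> (2 : R) * 0.
    by apply: cvgM; [exact: cvg_cst|exact: cvg_harmonic].
  by rewrite mulr0 in H.
near=> n.
(* The radius [2 / N] makes the open ball contain the closed support of the kernel. The kernel is at
   most [4 * N] and the ball has length [4 / N], so the error is at most 16 times the mean deviation
   over the ball. *)
have dn : (davg u x (2 / n.+1%:R) < (e / 16)%:E)%E.
  near: n; apply: (d_cvg [set y | y < (e / 16)%:E]%E).
  have h : (0 < (e / 16)%:E)%E by rewrite lte_fin divr_gt0.
  exact: (open_ereal_lt' h).
rewrite I; set N := n.+1%:R; have N0 : 0 < N by rewrite ltr0Sn.
set A := [set` `[x, x + N^-1]].
have mA : measurable A by exact: measurable_itv.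
have fA : (mu A < +oo)%E by rewrite lebesgue_measure_itv /=; case: ifP => _; rewrite ltry.
have mk : measurable_fun A (step_kernel n x).
  by apply: continuous_measurable_on => //; exact: scale_dstep_continuous.
have IuA : mu.-integrable A (EFin \o (fun z => (u z - u x) * step_kernel n x z)).
  by apply: (intg_mul_bounded _ _ _ (4 * N)) => //; [exact: Iusub|move=> z _; exact: step_kernel_bound].
have E1 : \int[mu]_(z in A) (u z * step_kernel n x z) - u x = \int[mu]_(z in A) ((u z - u x) * step_kernel n x z).
  transitivity (\int[mu]_(z in A) (u z * step_kernel n x z) - \int[mu]_(z in A) (u x * step_kernel n x z)).
    rewrite RintegralZl ?step_kernel_int ?mulr1 //.
    rewrite (_ : step_kernel n x = fun z => cst 1 z * step_kernel n x z); last by apply/funext => z; rewrite mul1r.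
    apply: (intg_mul_bounded _ _ _ (4 * N)) => //; last by move=> z _; exact: step_kernel_bound.
    exact: intg_cst.
  rewrite -RintegralB //.
  - by apply: eq_Rintegral => z _; rewrite mulrBl.
  - apply: (intg_mul_bounded _ _ _ (4 * N)) => //; last by move=> z _; exact: step_kernel_bound.
    exact: integrableS Iu.
  - apply: (intg_mul_bounded _ _ _ (4 * N)) => //; last by move=> z _; exact: step_kernel_bound.
    exact: intg_cst.
rewrite distrC E1; apply: (le_trans (le_normr_Rintegral _ IuA)) => //.
set B := ball x (2 / N).
have mB : measurable B by exact: measurable_ball.
have muB : mu B = (4 / N)%:E.
  rewrite lebesgue_measure_ball; last exact: ltW (r0 n).
  by rewrite -mulrnAl -mulrnA.
have IB : mu.-integrable B (EFin \o (fun z => u z - u x)) by apply: Iusub => //; rewrite muB ltry.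
have AB : A `<=` B.
  move=> z; rewrite /A /B /= in_itv /= /ball /= => /andP[h1 h2].
  rewrite distrC ger0_norm ?subr_ge0 //.
  have : 0 < N^-1 by rewrite invr_gt0.
  move: h2; rewrite mulrC; set q := N^-1; lra.
have InA : mu.-integrable A (EFin \o (fun z => `|u z - u x|)).
  by apply: integrable_norm; exact: integrableS IB.
have InB : mu.-integrable B (EFin \o (fun z => `|u z - u x|)) by exact: integrable_norm.
have le1 : \int[mu]_(z in A) `|(u z - u x) * step_kernel n x z| <= 4 * N * \int[mu]_(z in A) `|u z - u x|.
  rewrite -RintegralZl //; apply: le_Rintegral => //.
  - exact: integrable_norm.
  - exact: intgZ.
  - by move=> z _; rewrite normrM mulrC ler_wpM2r // step_kernel_bound.
apply: (le_trans le1).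
have le2 : \int[mu]_(z in A) `|u z - u x| <= \int[mu]_(z in B) `|u z - u x|.
  apply: fine_le; [exact: integrable_fin_num|exact: integrable_fin_num|].
  apply: ge0_subset_integral => //; first by case/integrableP: InB.
have E2 : davg u x (2 / N) = ((4 / N)^-1 * \int[mu]_(z in B) `|u z - u x|)%:E.
  rewrite /davg /iavg -/B muB inver mulf_eq0 invr_eq0 !(gt_eqF N0) pnatr_eq0 /= EFinM; congr (_ * _)%E.
  by rewrite /Rintegral fineK //; exact: integrable_fin_num.
move: dn; rewrite -/N E2 lte_fin invf_div => dn.
have : 4 * N * \int[mu]_(z in A) `|u z - u x| <= 4 * N * \int[mu]_(z in B) `|u z - u x|.
  by rewrite ler_wpM2l // mulr_ge0 // ltW.
move=> /le_trans; apply; move: dn; set j := Rintegral _ _ _; lra.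
Unshelve. all: by end_near. Qed.
End Weak.

(** * Functions with an integrable weak derivative are primitives almost everywhere *)

Section WeakRep.
Context {R : realType}.
Local Notation mu := (@lebesgue_measure R).
Implicit Types (u g f : R -> R) (a b c x y z : R).

Definition weak_deriv a b u g := forall phi, test_function a b phi ->
  \int[mu]_(x in `]a, b[) (u x * derive1 phi x) = - \int[mu]_(x in `]a, b[) (g x * phi x).

Lemma Rintegral_patchM (A : set R) f k :
  \int[mu]_(x in A) (f x * k x) = \int[mu]_x ((f \_ A) x * k x).
Proof.
rewrite Rintegral_mkcond; apply: eq_Rintegral => x _; rewrite !patchE.
by case: ifP => //; rewrite mul0r.
Qed.

(* The test functions [bump n.+1 x y] tend to the indicator of [x, y], and the integral
   of [u] against their derivatives to [u x - u y] at Lebesgue points. *)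
Lemma weak_deriv_primitive a b u g : mu.-integrable `]a, b[ (EFin \o u) ->
  mu.-integrable `]a, b[ (EFin \o g) -> weak_deriv a b u g ->
  exists c, ae_eq mu `]a, b[%classic u (fun x => c + \int[mu]_(z in `[a, x]) g z).
Proof.
move=> Iu Ig W; set I := `]a, b[%classic.
pose U := u \_ I; pose G := g \_ I.
have IU : mu.-integrable setT (EFin \o U) by apply: intg_patch => //; exact: measurable_itv.
have IG : mu.-integrable setT (EFin \o G) by apply: intg_patch => //; exact: measurable_itv.
have Lae : {ae mu, forall x, lebesgue_pt U x}.
  by apply: lebesgue_differentiation; apply: open_integrable_locally => //; exact: openT.
(* [U + T] will be constant on the Lebesgue points of []a, b[]. Tails appear because the scaled
   steps tend to indicators of half-lines. *)
pose T x := \int[mu]_(z in `]x, +oo[) G z.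
have key x y : a < x -> x < y -> y < b -> lebesgue_pt U x -> lebesgue_pt U y ->
    U x + T x = U y + T y.
  move=> ax xy yb Lx Ly.
  have bk k : continuous k -> (exists M, forall z, `|k z| <= M) -> forall f,
      mu.-integrable setT (EFin \o f) -> mu.-integrable setT (EFin \o (fun z => f z * k z)).
    move=> ck [M kM] f If; apply: (intg_mul_bounded _ _ _ M) => //.
    exact: continuous_measurable_on.
  have c1 : \int[mu]_z (U z * step_kernel n x z) - \int[mu]_z (U z * step_kernel n y z) @[n --> \oo]
      --> U x - U y.
    by apply: cvgB; exact: step_kernel_cvg.
  have c2 : - (\int[mu]_z (G z * step (n.+1%:R * (z - x)))
               - \int[mu]_z (G z * step (n.+1%:R * (z - y)))) @[n --> \oo]
      --> - (T x - T y).
    by apply: cvgN; apply: cvgB; exact: step_scale_integral_cvg.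
  suff E : U x - U y = - (T x - T y) by lra.
  (* The two sequences are the two sides of the weak formulation; they coincide as soon as
     [y + n.+1^-1 < b], when the bump becomes an admissible test function. *)
  apply: (cvg_unique _ c1) => //; apply: cvg_trans c2; apply: near_eq_cvg.
  have by0 : 0 < b - y by rewrite subr_gt0.
  near=> n.
  have test : test_function a b (bump (n.+1%:R) x y).
    apply: bump_test_function => //; first exact: ltW.
    rewrite -ltrBrDl.
    near: n; exact: (near_infty_natSinv_lt (PosNum by0)).
  have k1 w : continuous (step_kernel n w) by exact: scale_dstep_continuous.
  have k2 w : exists M, forall z, `|step_kernel n w z| <= M by exists (4 * n.+1%:R); exact: step_kernel_bound.
  have s1 w : continuous (fun z => step (n.+1%:R * (z - w))) by exact: step_scale_continuous.
  have s2 w : exists M, forall z, `|step (n.+1%:R * (z - w))| <= M.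
    by exists 1 => z; rewrite ger0_norm ?step_ge0 ?step_le1.
  rewrite -!RintegralB //; try (by apply: bk).
  have := W _ test; rewrite (Rintegral_patchM _ u) (Rintegral_patchM _ g) => WW.
  transitivity (- \int[mu]_x0 ((g \_ `]a, b[) x0 * bump n.+1%:R x y x0)).
    congr (- _); apply: eq_Rintegral => z _; exact/esym/mulrBr.
  rewrite -WW; apply: eq_Rintegral => z _; rewrite derive1_bump; exact: mulrBr.
(* Without a Lebesgue point in []a, b[], as when [b <= a], almost every point lies outside the
   interval and any constant serves. *)
have [[x0 [/andP[ax0 x0b] L0]]|no] := pselect (exists x, a < x < b /\ lebesgue_pt U x); last first.
  exists 0; move: Lae; apply: ae_imp => x Lx; rewrite /I /= in_itv /= => axb.
  by exfalso; apply: no; exists x.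
exists (U x0 + T x0 - \int[mu]_(z in `[a, +oo[) G z).
move: Lae; apply: ae_imp => x Lx; rewrite /I /= in_itv /= => axb; have /andP[ax xb] := axb.
have -> : u x = U x by rewrite /U patchE mem_set //= in_itv.
have E : U x + T x = U x0 + T x0.
  have [h|h|->//] := ltgtP x x0; [exact: key|exact/esym/key].
have -> : \int[mu]_(z in `[a, x]) g z = \int[mu]_(z in `[a, +oo[) G z - T x.
  have IGa : mu.-integrable `[a, +oo[ (EFin \o G) by exact: integrableS IG.
  rewrite /T -(Rintegral_itvB IGa) ?bnd_simp ?(ltW ax) // opprB addrC subrK.
  have sub : `]a, x] `<=` I by move=> z; rewrite /I /= !in_itv /= => /andP[-> /le_lt_trans ->].
  rewrite -!Rintegral_itv_obnd_cbnd; last 2 first.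
  - by apply: integrableS IG.
  - by apply: integrableS Ig => //; exact: measurable_itv.
  by apply: eq_Rintegral => z; rewrite inE => /sub Iz; rewrite /G patchE mem_set.
rewrite -E; lra.
Unshelve. all: by end_near. Qed.
End WeakRep.

(** * The product rule for primitives of integrable functions *)

Section Fub.
Context {R : realType}.
Local Notation mu := (@lebesgue_measure R).
Implicit Types (p q f g : R -> R) (a b c x y z : R).

Lemma EFin_Rintegral (A : set R) f : measurable A -> mu.-integrable A (EFin \o f) ->
  (\int[mu]_(x in A) f x)%:E = (\int[mu]_(x in A) (f x)%:E)%E.
Proof. by move=> mA If; rewrite /Rintegral fineK //; exact: integrable_fin_num. Qed.

(** Both sides are iterated integrals of [p s * q t] over the half-plane [t <= s]. Integrability
    there follows from Tonelli: the inner integral of the absolute value is at most [|p s|] times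
    the L^1 norm of [q]. *)
Lemma triangle_fubini p q :
  mu.-integrable setT (EFin \o p) -> mu.-integrable setT (EFin \o q) ->
  \int[mu]_s (p s * \int[mu]_(t in `]-oo, s]) q t) =
  \int[mu]_t (q t * \int[mu]_(s in `[t, +oo[) p s).
Proof.
move=> Ip Iq.
pose T := measurableTypeR R.
have mp : measurable_fun (setT : set T) p by exact: intg_measurable.
have mq : measurable_fun (setT : set T) q by exact: intg_measurable.
pose D : set (T * T) := [set z | z.2 <= z.1].
pose f (z : T * T) : \bar R := (p z.1 * q z.2 * \1_D z)%:E.
have mD : measurable D.
  rewrite -[D]setTI; apply: measurable_fun_le => //.
have mf : measurable_fun setT f.
  apply/measurable_EFinP; apply: measurable_funM; last exact: measurable_indic.
  apply: measurable_funM; first exact: (measurableT_comp mp measurable_fst).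
  exact: (measurableT_comp mq measurable_snd).
have ID (s t : R) : \1_D (s, t) = \1_(`]-oo, s]%classic) t :> R.
  by rewrite !indicE; congr (nat_of_bool _)%:R; apply/idP/idP; rewrite !inE /D /= in_itv.
have ID' (s t : R) : \1_D (s, t) = \1_(`[t, +oo[%classic) s :> R.
  by rewrite !indicE; congr (nat_of_bool _)%:R; apply/idP/idP; rewrite !inE /D /= in_itv /= andbT.
have indI (A : set R) h : measurable A -> mu.-integrable setT (EFin \o h) ->
    mu.-integrable setT (EFin \o (fun t => h t * \1_A t)).
  move=> mA Ih; apply: (intg_mul_bounded _ _ _ 1) => //.
  by move=> z _; rewrite indicE; case: (_ \in _); rewrite ?normr1 ?normr0.
have indR (A : set R) h : \int[mu]_t (h t * \1_A t) = \int[mu]_(t in A) h t.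
  rewrite [RHS]Rintegral_mkcond; apply: eq_Rintegral => z _.
  by rewrite patchE indicE; case: ifP => _; rewrite ?mulr1 ?mulr0.
have If : (mu \x mu)%E.-integrable setT f.
  apply/integrable12ltyP => //.
  pose C := \int[mu]_t `|q t|.
  have In : mu.-integrable setT (EFin \o (fun t => `|q t|)) by exact: integrable_norm.
  have Ipn : mu.-integrable setT (EFin \o (fun t => `|p t| * C)).
    exact: (intgZr _ _ _ measurableT (integrable_norm Ip)).
  have : (\int[mu]_s (`|p s| * C)%:E < +oo)%E.
    by rewrite -EFin_Rintegral // ltry.
  apply: le_lt_trans; apply: ge0_le_integral => //.
  - by move=> x _; apply: integral_ge0.
  - have H : measurable_fun setT (abse \o f) by exact: measurableT_comp.
    apply: (measurable_fun_fubini_tonelli_F (m2 := mu) (abse \o f)) => // z; exact: abse_ge0.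
  - by apply/measurable_EFinP; exact: intg_measurable.
  - move=> s _; rewrite /C -RintegralZl // EFin_Rintegral //; last exact: intgZ.
    apply: ge0_le_integral => //.
    + apply: measurableT_comp => //; exact: (measurableT_comp mf (pair1_measurable s)).
    + by apply/measurable_EFinP; apply: measurable_funM => //; apply: measurableT_comp.
    + move=> t _; rewrite /f /= lee_fin !normrM -[X in _ <= X]mulr1 ler_wpM2l ?mulr_ge0 // indicE; case: (_ \in _); rewrite ?normr1 ?normr0 //.
apply: (congr1 fine).
transitivity (\int[mu]_s \int[mu]_t f (s, t))%E.
  apply: eq_integral => s _; rewrite -indR -RintegralZl ?EFin_Rintegral //; try by apply: indI => //; exact: measurable_itv.
    by apply: eq_integral => t _; rewrite /f /= ID mulrA.
  by apply: intgZ => //; apply: indI => //; exact: measurable_itv.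
rewrite (Fubini If); apply: eq_integral => t _.
rewrite -indR -RintegralZl ?EFin_Rintegral //; try by apply: indI => //; exact: measurable_itv.
  by apply: eq_integral => s _; rewrite /f /= ID' mulrA [q t * _]mulrC.
by apply: intgZ => //; apply: indI => //; exact: measurable_itv.
Qed.
End Fub.

(** * Absolutely continuous functions on a segment and their products *)

Section AbsCont.
Context {R : realType}.
Local Notation mu := (@lebesgue_measure R).
Implicit Types (p q f g : R -> R) (a b c x y z : R).

Lemma intg_mul_within a b p k : mu.-integrable `[a, b] (EFin \o p) ->
  {within `[a, b], continuous k} -> mu.-integrable `[a, b] (EFin \o (fun z => p z * k z)).
Proof.
move=> Ip ck.
have [M [_ kM]] : bounded_set (k @` `[a, b]).
  by apply: compact_bounded; apply: continuous_compact => //; exact: segment_compact.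
apply: (intg_mul_bounded _ _ _ (M + 1)) => //.
- by apply: subspace_continuous_measurable_fun => //; exact: measurable_itv.
- by move=> z zab; apply: (kM (M + 1)); [rewrite ltrDl|exists z].
Qed.

Definition prim a g x := \int[mu]_(z in `[a, x]) g z.

Lemma prim_continuous a b g : a <= b -> mu.-integrable `[a, b] (EFin \o g) ->
  {within `[a, b], continuous (prim a g)}.
Proof. exact: parameterized_integral_continuous. Qed.

Lemma intg_sub_itv a b x g : x <= b -> mu.-integrable `[a, b] (EFin \o g) ->
  mu.-integrable `[a, x] (EFin \o g).
Proof.
move=> xb Ig; apply: integrableS Ig => //.
by move=> z; rewrite /= !in_itv /= => /andP[-> /le_trans ->].
Qed.

Lemma prim_split a b x g : a <= x <= b -> mu.-integrable `[a, b] (EFin \o g) ->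
  \int[mu]_(z in `[x, b]) g z = prim a g b - prim a g x.
Proof.
move=> /andP[ax xb] Ig; rewrite /prim Rintegral_itvB ?bnd_simp //.
rewrite Rintegral_itv_obnd_cbnd //; apply: integrableS Ig => //.
by move=> z; rewrite /= !in_itv /= => /andP[/ltW/(le_trans ax) -> ->].
Qed.

Lemma Rintegral_patch (A B : set R) g : \int[mu]_(z in A) (g \_ B) z = \int[mu]_(z in A `&` B) g z.
Proof. by rewrite Rintegral_mkcondr. Qed.

(** [triangle_fubini] for the restrictions to [[a, x]]: one inner integral is [prim a q s], the
    other is [prim a p x - prim a p t]. Moving the last term across gives the product rule. *)
Lemma prim_mul a x p q : a <= x -> mu.-integrable `[a, x] (EFin \o p) ->
    mu.-integrable `[a, x] (EFin \o q) ->
  prim a p x * prim a q x =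
  \int[mu]_(z in `[a, x]) (p z * prim a q z) + \int[mu]_(z in `[a, x]) (q z * prim a p z).
Proof.
move=> ax Ip Iq.
have Cp := prim_continuous a x p ax Ip.
have Iqp := intg_mul_within _ _ _ _ Iq Cp.
have E1 : \int[mu]_(z in `[a, x]) (p z * prim a q z) =
   \int[mu]_(s in `[a, x]) (p s * \int[mu]_(t in `]-oo, s]) (q \_ `[a, x]) t).
  apply: eq_Rintegral => s; rewrite inE /= in_itv /= => /andP[as_ sx].
  rewrite Rintegral_patch; congr (_ * Rintegral _ _ _).
  apply/seteqP; split => z /=; rewrite !in_itv /=.
    by move=> /andP[-> zs]; rewrite zs (le_trans zs sx).
  by case=> -> /andP[-> _].
have E2 : \int[mu]_(t in `[a, x]) (q t * \int[mu]_(s in `[t, +oo[) (p \_ `[a, x]) s) =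
   \int[mu]_(z in `[a, x]) (q z * prim a p x - q z * prim a p z).
  apply: eq_Rintegral => t; rewrite inE /= in_itv /= => /andP[at_ tx].
  have atx : a <= t <= x by rewrite at_.
  rewrite Rintegral_patch -mulrBr -(prim_split a x t p atx Ip).
  congr (_ * Rintegral _ _ _).
  apply/seteqP; split => z /=; rewrite !in_itv /= ?andbT; first by move=> [-> /andP[_ ->]].
  by move=> /andP[tz ->]; rewrite tz (le_trans at_ tz).
have E3 : \int[mu]_(z in `[a, x]) (q z * prim a p x - q z * prim a p z) =
   prim a q x * prim a p x - \int[mu]_(z in `[a, x]) (q z * prim a p z).
  rewrite (RintegralB _ (intgZr _ (prim a p x) _ (measurable_itv _) Iq) Iqp) //.
  by rewrite (RintegralZr (prim a p x) _ Iq).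
have := triangle_fubini (p \_ `[a, x]) (q \_ `[a, x])
  (intg_patch _ _ (measurable_itv _) Ip) (intg_patch _ _ (measurable_itv _) Iq).
by rewrite -!Rintegral_patchM -E1 E2 E3 => ->; rewrite subrK mulrC.
Qed.

(* [f] is absolutely continuous on [a, b] with derivative [f'] a.e. *)
Definition AC a b f f' := mu.-integrable `[a, b] (EFin \o f') /\
  forall x, a <= x <= b -> f x = f a + prim a f' x.

Lemma AC_continuous a b f f' : a <= b -> AC a b f f' -> {within `[a, b], continuous f}.
Proof.
move=> ab [If E].
have : {within `[a, b], continuous (fun x => f a + prim a f' x)}.
  by move=> x; apply: cvgD; [exact: cvg_cst|exact: prim_continuous].
by apply: subspace_eq_continuous => x; rewrite inE /= in_itv /= => xab; rewrite [RHS]E.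
Qed.

Lemma AC_int a b f f' : a <= b -> AC a b f f' -> \int[mu]_(x in `[a, b]) f' x = f b - f a.
Proof. by move=> ab [If E]; rewrite (E b) ?ab ?lexx // addrC addKr. Qed.

Lemma intg_cst_itv a b c : mu.-integrable `[a, b] (EFin \o cst c).
Proof. by apply: intg_cst => //; rewrite lebesgue_measure_itv /=; case: ifP => _; rewrite ltry. Qed.

Lemma AC_cst a b c : AC a b (cst c) (cst 0).
Proof.
split; first exact: intg_cst_itv.
by move=> x _; rewrite /prim /= Rintegral_cst // mul0r addr0.
Qed.

Lemma AC_id a b : AC a b id (cst 1).
Proof.
split; first exact: intg_cst_itv.
move=> x /andP[ax xb]; rewrite /prim Rintegral_cst //= mul1r lebesgue_measure_itv /= lte_fin.
case: ltP => h /=; rewrite /id; lra.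
Qed.

Lemma AC_add a b f f' g g' : AC a b f f' -> AC a b g g' ->
  AC a b (fun x => f x + g x) (fun x => f' x + g' x).
Proof.
move=> [If Ef] [Ig Eg]; split; first exact: intgD.
move=> x /[dup] /andP[ax xb] axb; rewrite /prim RintegralD //; try exact: intg_sub_itv xb _.
by rewrite (Ef x axb) (Eg x axb) addrACA.
Qed.

(** Once the values at [a] are split off, every term is linear in a primitive except the product of
    the two primitives, which is [prim_mul]. *)
Lemma AC_mul a b f f' g g' : a <= b -> AC a b f f' -> AC a b g g' ->
  AC a b (fun x => f x * g x) (fun x => f' x * g x + g' x * f x).
Proof.
move=> ab Af Ag; have cf := AC_continuous _ _ _ _ ab Af; have cg := AC_continuous _ _ _ _ ab Ag.
case: Af => If Ef; case: Ag => Ig Eg.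
split; first by apply: intgD => //; exact: intg_mul_within.
move=> x /[dup] /andP[ax xb] axb; rewrite /prim.
have Ifx := intg_sub_itv _ _ _ _ xb If; have Igx := intg_sub_itv _ _ _ _ xb Ig.
have Ifp : mu.-integrable `[a, x] (EFin \o (fun z => f' z * prim a g' z)).
  by apply: intg_mul_within => //; exact: prim_continuous.
have Igp : mu.-integrable `[a, x] (EFin \o (fun z => g' z * prim a f' z)).
  by apply: intg_mul_within => //; exact: prim_continuous.
have E z : `[a, x]%classic z -> f' z * g z + g' z * f z =
    (f' z * g a + g' z * f a) + (f' z * prim a g' z + g' z * prim a f' z).
  rewrite /= in_itv /= => /andP[az zx]; rewrite (Ef z) ?(Eg z) ?az ?(le_trans zx xb) //; ring.
under eq_Rintegral => z zax do rewrite (E z (set_mem zax)).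
rewrite RintegralD //; [|by apply: intgD => //; exact: intgZr|exact: intgD].
rewrite RintegralD //; [|exact: intgZr|exact: intgZr].
rewrite [X in _ = _ + (_ + X)]RintegralD // -prim_mul //.
rewrite !RintegralZr // (Ef x axb) (Eg x axb) -/(prim a f' x) -/(prim a g' x); ring.
Qed.

End AbsCont.

(** * H^1 functions on an interval *)

Section RealSobolev.
Context {R : realType}.
Local Notation mu := (@lebesgue_measure R).
Implicit Types (p q f g u : R -> R) (a b c x y z : R).

Lemma intg_oo_cc a b f : mu.-integrable `]a, b[ (EFin \o f) ->
  mu.-integrable `[a, b] (EFin \o f).
Proof.
move=> If; have mf := intg_measurable _ _ If.
have mf' : measurable_fun `]a, b[ (EFin \o f) by apply/measurable_EFinP.
case/integrableP: If => _ If; apply/integrableP; split.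
  apply/measurable_EFinP/measurable_fun_itv_bndo_bndcP.
  exact/measurable_fun_itv_obnd_cbndP.
rewrite integral_itv_bndoo //.
by apply: measurableT_comp.
Qed.

Lemma Rintegral_oo_cc a b f : mu.-integrable `]a, b[ (EFin \o f) ->
  \int[mu]_(x in `]a, b[) f x = \int[mu]_(x in `[a, b]) f x.
Proof.
move=> If; rewrite /Rintegral [in RHS]integral_itv_bndoo //.
by apply/measurable_EFinP; exact: intg_measurable.
Qed.

Lemma ae_eq_Rintegral (A : set R) f g : measurable A -> mu.-integrable A (EFin \o f) ->
  mu.-integrable A (EFin \o g) -> {ae mu, forall x, A x -> f x = g x} ->
  \int[mu]_(x in A) f x = \int[mu]_(x in A) g x.
Proof.
move=> mA If Ig fg; apply: (congr1 fine); apply: ae_eq_integral => //.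
- by apply/measurable_EFinP; exact: intg_measurable.
- by apply/measurable_EFinP; exact: intg_measurable.
- by apply: ae_imp fg => x fg Ax; rewrite fg.
Qed.

Lemma ae_itv_inhabited a b (P : R -> Prop) : a < b -> {ae mu, forall x, P x} ->
  exists2 x, a < x < b & P x.
Proof.
move=> ab HP; apply: contrapT => no.
have N : mu.-negligible `]a, b[%classic.
  apply: negligibleS HP => x /=; rewrite in_itv /= => xab Px.
  by apply: no; exists x.
have : mu `]a, b[%classic = 0%E by apply: measure_negligible N; exact: measurable_itv.
move=> /eqP; rewrite lebesgue_measure_itv /= lte_fin ab -EFinB eqe subr_eq0 => /eqP ba.
by rewrite ba ltxx in ab.
Qed.

(** If [f - g] were nonzero at [x], it would be nonzero on a relative neighbourhood of [x] in
    [[a, b]]; this contains a nonempty open interval even when [x] is an end point. That case is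
    what makes traces well defined. *)
Lemma within_continuous_ae_eq a b f g : a < b ->
  {within `[a, b], continuous f} -> {within `[a, b], continuous g} ->
  ae_eq mu `]a, b[%classic f g -> forall x, a <= x <= b -> f x = g x.
Proof.
move=> ab cf cg fg x xab; apply/eqP; apply: contraT => nfg.
have xab' : `[a, b]%classic x by rewrite /= in_itv.
have : f z - g z @[z --> within `[a, b] (nbhs x)] --> f x - g x.
  move/subspace_continuousP: cf => /(_ x xab') cf.
  move/subspace_continuousP: cg => /(_ x xab') cg.
  exact: cvgB.
move=> /cvgrPdist_lt /(_ `|f x - g x|); rewrite normr_gt0 subr_eq0 => /(_ nfg).
rewrite near_withinE => -[d /= d0 H].
have lt : Num.max a (x - d) < Num.min b (x + d).
  by rewrite lt_min !gt_max ab /=; move: xab => /andP[ax xb]; apply/and3P; split; lra.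
have [y + E] := ae_itv_inhabited _ _ _ lt fg.
rewrite gt_max lt_min => /andP[/andP[ay xy] /andP[yb yx]].
have {}E : f y = g y by apply: E; rewrite /= in_itv /= ay yb.
have := H y; rewrite /= E subrr subr0 ltxx => /(_ _ _); apply.
  by rewrite ltr_distlC; lra.
by rewrite in_itv /= (ltW ay) (ltW yb).
Qed.

(** By Lebesgue differentiation the primitive has derivative [f] almost everywhere, while it is
    locally constant inside the interval. *)
Lemma prim_eq0_ae a b f : a < b -> mu.-integrable `]a, b[ (EFin \o f) ->
  (forall x, a <= x <= b -> prim a f x = 0) -> ae_eq mu `]a, b[%classic f (cst 0).
Proof.
move=> ab If f0; pose G := f \_ `]a, b[.
have IG : mu.-integrable setT (EFin \o G) by apply: intg_patch => //; exact: measurable_itv.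
have lG : locally_integrable setT G by apply: open_integrable_locally => //; exact: openT.
have Iy y : mu.-integrable [set` Interval (BLeft a) (BRight y)] (EFin \o G) by exact: integrableS IG.
have := @FTC1 _ G (BLeft a) Iy lG.
apply: ae_imp => x H; rewrite /= in_itv /= => /andP[ax xb].
have ax' : (ereal_of_itv_bound (BLeft a) < ereal_of_itv_bound (BRight x))%E by rewrite /= lte_fin.
have [_] := H ax'.
have -> : G x = f x by rewrite /G patchE mem_set //= in_itv /= ax xb.
move=> <-.
rewrite derive1E; set F := (F in derive F).
have -> : 'D_1 F x = 'D_1 (cst 0 : R -> R) x.
  apply: near_eq_derive.
  near=> y.
  have ay : a < y by near: y; exact: lt_nbhsr.
  have yb : y < b by near: y; exact: lt_nbhsl.
  have Ifc := intg_oo_cc _ _ _ If.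
  rewrite /F /= -(f0 y) ?(ltW ay) ?(ltW yb) // /prim -!Rintegral_itv_obnd_cbnd; last 2 first.
  - exact: integrableS IG.
  - apply: integrableS Ifc => //.
    by move=> z /=; rewrite !in_itv /= => /andP[/ltW -> /le_trans ->//]; exact: ltW.
  apply: eq_Rintegral => z; rewrite inE /= in_itv /= => /andP[az zy].
  by rewrite /G patchE mem_set //= in_itv /= az (le_lt_trans zy).
exact: derive_cst.
Unshelve. all: by end_near. Qed.

(** Both weak derivatives yield a continuous primitive representing [u]. The two primitives agree on
    all of [[a, b]]; at [a] this identifies the constants, and the primitive of [g1 - g2]
    vanishes. *)
Lemma weak_deriv_unique a b u g1 g2 : a < b -> mu.-integrable `]a, b[ (EFin \o u) ->
  mu.-integrable `]a, b[ (EFin \o g1) -> mu.-integrable `]a, b[ (EFin \o g2) ->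
  weak_deriv a b u g1 -> weak_deriv a b u g2 -> ae_eq mu `]a, b[%classic g1 g2.
Proof.
move=> ab Iu I1 I2 W1 W2.
have [c1 E1] := weak_deriv_primitive _ _ _ _ Iu I1 W1; have [c2 E2] := weak_deriv_primitive _ _ _ _ Iu I2 W2.
have J1 := intg_oo_cc _ _ _ I1; have J2 := intg_oo_cc _ _ _ I2.
have cc c g : mu.-integrable `[a, b] (EFin \o g) -> {within `[a, b], continuous (fun x => c + prim a g x)}.
  by move=> Ig x; apply: cvgD; [exact: cvg_cst|apply: prim_continuous => //; exact: ltW].
have E x : a <= x <= b -> c1 + prim a g1 x = c2 + prim a g2 x.
  move=> xab; apply: (within_continuous_ae_eq a b (fun x => c1 + prim a g1 x)
    (fun x => c2 + prim a g2 x)) => //; [exact: cc|exact: cc|].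
  by apply: ae_imp2 E1 E2 => y h1 h2 yI; rewrite -h1 // -h2.
have P0 g : prim a g a = 0 by rewrite /prim set_itv1 Rintegral_set1.
have c12 : c1 = c2 by have := E a; rewrite !P0 !addr0 lexx ltW //; exact.
have : ae_eq mu `]a, b[%classic (fun x => g1 x - g2 x) (cst 0).
  apply: prim_eq0_ae => //; first exact: intgB.
  move=> x /[dup] xab /andP[ax xb]; rewrite /prim RintegralB //; try exact: intg_sub_itv xb _.
  by have := E x xab; rewrite c12 /prim => /addrI ->; rewrite subrr.
by apply: ae_imp => x h /h /= /eqP; rewrite subr_eq0 => /eqP.
Qed.

End RealSobolev.

Local Open Scope complex_scope.

(** * Complex L^2 functions through their real and imaginary parts *)

Section ComplexSobolev.
Context {R : realType}.
Local Notation mu := (@lebesgue_measure R).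
Local Notation Re := complex.Re.
Local Notation Im := complex.Im.
Implicit Types (f g u w : R -> R[i]) (p q : R -> R) (a b c x y : R).

Lemma ReD (z1 z2 : R[i]) : Re (z1 + z2) = Re z1 + Re z2. Proof. by case: z1; case: z2. Qed.
Lemma ImD (z1 z2 : R[i]) : Im (z1 + z2) = Im z1 + Im z2. Proof. by case: z1; case: z2. Qed.
Lemma ReB (z1 z2 : R[i]) : Re (z1 - z2) = Re z1 - Re z2. Proof. by case: z1; case: z2. Qed.
Lemma ImB (z1 z2 : R[i]) : Im (z1 - z2) = Im z1 - Im z2. Proof. by case: z1; case: z2. Qed.
Lemma ReZ (c : R) (z : R[i]) : Re (c%:C * z) = c * Re z.
Proof. by case: z => x y /=; rewrite mul0r subr0. Qed.
Lemma ImZ (c : R) (z : R[i]) : Im (c%:C * z) = c * Im z.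
Proof. by case: z => x y /=; rewrite mul0r addr0. Qed.
Lemma eq_ReIm (z1 z2 : R[i]) : Re z1 = Re z2 -> Im z1 = Im z2 -> z1 = z2.
Proof. by case: z1 => a1 b1; case: z2 => a2 b2 /= -> ->. Qed.

Lemma sqnormcE (z : R[i]) : sqnormc z = Re z ^+ 2 + Im z ^+ 2.
Proof. by case: z => x y; rewrite /sqnormc /= sqr_sqrtr // addr_ge0 // sqr_ge0. Qed.

Definition sqintegrable a b p := measurable_fun `]a, b[ p /\
  mu.-integrable `]a, b[ (EFin \o (fun x => p x ^+ 2)).

Lemma intg_le (A : set R) p q : measurable A -> measurable_fun A p ->
  mu.-integrable A (EFin \o q) -> (forall x, A x -> `|p x| <= q x) ->
  mu.-integrable A (EFin \o p).
Proof.
move=> mA mp Iq pq; apply: (le_integrable _ _ _ Iq) => //; first exact/measurable_EFinP.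
by move=> x Ax; rewrite lee_fin (le_trans (pq _ Ax)) // ler_norm.
Qed.

Lemma sqintegrable_mul a b p q : sqintegrable a b p -> sqintegrable a b q ->
  mu.-integrable `]a, b[ (EFin \o (fun x => p x * q x)).
Proof.
move=> [mp Ip] [mq Iq]; apply: (intg_le _ _ (fun x => p x ^+ 2 + q x ^+ 2)) => //.
- exact: measurable_funM.
- exact: intgD.
- by move=> x _; rewrite ler_norml; apply/andP; split; nra.
Qed.

Lemma sqintegrable_cst a b c : sqintegrable a b (cst c).
Proof.
split; first exact: measurable_cst.
by apply: (intg_cst _ (c ^+ 2)) => //; rewrite lebesgue_measure_itv /=; case: ifP => _; rewrite ltry.
Qed.

Lemma sqintegrable_intg a b p : sqintegrable a b p -> mu.-integrable `]a, b[ (EFin \o p).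
Proof.
move=> Lp; have := sqintegrable_mul _ _ _ _ Lp (sqintegrable_cst a b 1).
by congr (mu.-integrable _ _); apply/funext => x /=; rewrite mulr1.
Qed.

Lemma sqintegrable_add a b p q : sqintegrable a b p -> sqintegrable a b q ->
  sqintegrable a b (fun x => p x + q x).
Proof.
move=> Lp Lq; have I := sqintegrable_mul _ _ _ _ Lp Lq; move: Lp Lq => [mp Ip] [mq Iq].
split; first exact: measurable_funD.
have -> : (fun x => (p x + q x) ^+ 2) = (fun x => (p x ^+ 2 + 2 * (p x * q x)) + q x ^+ 2).
  by apply/funext => x; ring.
by apply: intgD => //; apply: intgD => //; exact: intgZ.
Qed.

Lemma sqintegrable_scale a b c p : sqintegrable a b p -> sqintegrable a b (fun x => c * p x).
Proof.
move=> [mp Ip]; split; first by apply: measurable_funM => //; exact: measurable_cst.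
have -> : (fun x => (c * p x) ^+ 2) = (fun x => c ^+ 2 * p x ^+ 2) by apply/funext => x; ring.
exact: intgZ.
Qed.

Lemma L2P a b f : L2 a b f <->
  sqintegrable a b (fun x => Re (f x)) /\ sqintegrable a b (fun x => Im (f x)).
Proof.
split.
- move=> [mr mi If]; have {}If : mu.-integrable `]a, b[ (EFin \o (fun x => Re (f x) ^+ 2 + Im (f x) ^+ 2)).
    by move: If; congr (mu.-integrable _ _); apply/funext => x /=; rewrite sqnormcE.
  split; split => //; apply: (intg_le _ _ _ _ _ If) => //; try exact: measurable_funX.
  + by move=> x _; rewrite ger0_norm ?sqr_ge0 // lerDl sqr_ge0.
  + by move=> x _; rewrite ger0_norm ?sqr_ge0 // lerDr sqr_ge0.
- move=> [[mr Ir] [mi Ii]]; split => //.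
  have : mu.-integrable `]a, b[ (EFin \o (fun x => Re (f x) ^+ 2 + Im (f x) ^+ 2)) by exact: intgD.
  by congr (mu.-integrable _ _); apply/funext => x /=; rewrite sqnormcE.
Qed.

Lemma L2_add a b f g : L2 a b f -> L2 a b g -> L2 a b (fun x => f x + g x).
Proof.
move=> /L2P[f1 f2] /L2P[g1 g2]; apply/L2P; split.
  by under eq_fun do rewrite ReD; exact: sqintegrable_add.
by under eq_fun do rewrite ImD; exact: sqintegrable_add.
Qed.

Lemma L2_scale a b c f : L2 a b f -> L2 a b (fun x => c%:C * f x).
Proof.
move=> /L2P[f1 f2]; apply/L2P; split.
  by under eq_fun do rewrite ReZ; exact: sqintegrable_scale.
by under eq_fun do rewrite ImZ; exact: sqintegrable_scale.
Qed.

Lemma L2_Re_intg a b f : L2 a b f -> mu.-integrable `]a, b[ (EFin \o (fun x => Re (f x))).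
Proof. by move=> /L2P[h _]; exact: sqintegrable_intg. Qed.

Lemma L2_Im_intg a b f : L2 a b f -> mu.-integrable `]a, b[ (EFin \o (fun x => Im (f x))).
Proof. by move=> /L2P[_ h]; exact: sqintegrable_intg. Qed.

Lemma weak_derivP a b u g : is_weak_derivative a b u g <->
  weak_deriv a b (fun x => Re (u x)) (fun x => Re (g x)) /\
  weak_deriv a b (fun x => Im (u x)) (fun x => Im (g x)).
Proof.
have E f p : cintegral a b (fun x => f x * (p x)%:C) =
    (\int[mu]_(x in `]a, b[) (Re (f x) * p x)) +i* (\int[mu]_(x in `]a, b[) (Im (f x) * p x)).
  rewrite /cintegral; congr (_ +i* _); apply: eq_Rintegral => x _;
  by rewrite mulrC ?ReZ ?ImZ mulrC.
split=> [W|[W1 W2] phi tphi].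
  by split=> phi /W; rewrite !E => -[].
by rewrite !E W1 // W2.
Qed.

Lemma cvg_complexP {T : Type} (F : set_system T) {FF : Filter F} (f : T -> R[i]) (l : R[i]) :
  ((f : T -> R[i]^o) @ F --> (l : R[i]^o)) <->
  (Re (f x) @[x --> F] --> Re l /\ Im (f x) @[x --> F] --> Im l).
Proof.
split.
- move=> /cvgrPdist_lt fl; split; apply/cvgrPdist_lt => e e0.
    have e0' : 0 < e%:C by rewrite ltcR.
    apply: filterS (fl _ e0') => x; rewrite normc_def ltcR -ReB => /(le_lt_trans _); apply.
    by rewrite -sqrtr_sqr ler_wsqrtr // lerDl sqr_ge0.
  have e0' : 0 < e%:C by rewrite ltcR.
  apply: filterS (fl _ e0') => x; rewrite normc_def ltcR -ImB => /(le_lt_trans _); apply.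
  by rewrite -sqrtr_sqr ler_wsqrtr // lerDr sqr_ge0.
- move=> [/cvgrPdist_lt fr /cvgrPdist_lt fi]; apply/cvgrPdist_lt => -[e e'].
  rewrite ltcE /= => /andP[/eqP -> e0].
  have e2 : 0 < e / 2 by rewrite divr_gt0.
  apply: filterS2 (fr _ e2) (fi _ e2) => x; rewrite -ReB -ImB => h1 h2.
  rewrite normc_def ltcR -[X in _ < X]gtr0_norm // -sqrtr_sqr ltr_sqrt ?exprn_gt0 //.
  rewrite -real_normK ?num_real // -[X in _ + X]real_normK ?num_real //.
  by move: h1 h2 (normr_ge0 (Re (l - f x))) (normr_ge0 (Im (l - f x))); nra.
Qed.

Lemma within_complexP (A : set R) (w : R -> R[i]) :
  {within A, continuous (w : R -> R[i]^o)} <->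
  {within A, continuous (fun x => Re (w x))} /\ {within A, continuous (fun x => Im (w x))}.
Proof.
split.
- by move=> cw; split=> x; have /cvg_complexP[] := cw x.
- by move=> [c1 c2] x; apply/cvg_complexP; split; [exact: c1|exact: c2].
Qed.

End ComplexSobolev.

(** * Linearity of weak derivatives and of traces on H^1 *)

Section H1Theory.
Context {R : realType}.
Local Notation mu := (@lebesgue_measure R).
Local Notation Re := complex.Re.
Local Notation Im := complex.Im.
Implicit Types (f g u w : R -> R[i]) (p q : R -> R) (a b c x y : R).

Lemma aeq_refl a b f : aeq a b f f.
Proof. exact/aeW. Qed.

Lemma aeq_sym a b f g : aeq a b f g -> aeq a b g f.
Proof. by apply: ae_imp => x h /h ->. Qed.

Lemma aeq_trans a b f g u : aeq a b f g -> aeq a b g u -> aeq a b f u.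
Proof. by apply: ae_imp2 => x h k xab; rewrite h // k. Qed.

Lemma intg_mul_continuous a b p (k : R -> R) : continuous k ->
  mu.-integrable `]a, b[ (EFin \o p) -> mu.-integrable `]a, b[ (EFin \o (fun x => p x * k x)).
Proof.
move=> ck Ip.
have : mu.-integrable `[a, b] (EFin \o (fun x => p x * k x)).
  by apply: intg_mul_within; [exact: intg_oo_cc|exact: continuous_subspaceT].
by apply: integrableS => //; exact: subset_itv_oo_cc.
Qed.

Lemma test_function_continuous a b (phi : R -> R) : test_function a b phi ->
  continuous phi /\ continuous (derive1 phi).
Proof.
move=> [dphi cphi _ _]; split=> // x.
by apply: differentiable_continuous; apply/derivable1_diffP.
Qed.

Lemma weak_deriv_add a b (p q p' q' : R -> R) :
  mu.-integrable `]a, b[ (EFin \o p) -> mu.-integrable `]a, b[ (EFin \o q) ->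
  mu.-integrable `]a, b[ (EFin \o p') -> mu.-integrable `]a, b[ (EFin \o q') ->
  weak_deriv a b p q -> weak_deriv a b p' q' ->
  weak_deriv a b (fun x => p x + p' x) (fun x => q x + q' x).
Proof.
move=> Ip Iq Ip' Iq' W W' phi tphi.
have [c0 c1] := test_function_continuous _ _ _ tphi.
under eq_Rintegral do rewrite mulrDl.
under [in RHS]eq_Rintegral do rewrite mulrDl.
rewrite !RintegralD //; try (by apply: intg_mul_continuous).
by rewrite W // W' // opprD.
Qed.

Lemma weak_deriv_scale a b c (p q : R -> R) :
  mu.-integrable `]a, b[ (EFin \o p) -> mu.-integrable `]a, b[ (EFin \o q) ->
  weak_deriv a b p q -> weak_deriv a b (fun x => c * p x) (fun x => c * q x).
Proof.
move=> Ip Iq W phi tphi.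
have [c0 c1] := test_function_continuous _ _ _ tphi.
under eq_Rintegral do rewrite -mulrA.
under [in RHS]eq_Rintegral do rewrite -mulrA.
rewrite !RintegralZl //; try (by apply: intg_mul_continuous).
by rewrite W // mulrN.
Qed.

Lemma weak_deriv_ae_eq a b (p p' q : R -> R) :
  mu.-integrable `]a, b[ (EFin \o p) -> mu.-integrable `]a, b[ (EFin \o p') ->
  ae_eq mu `]a, b[%classic p p' ->
  weak_deriv a b p q -> weak_deriv a b p' q.
Proof.
move=> Ip Ip' pp' W phi tphi.
have [c0 c1] := test_function_continuous _ _ _ tphi.
rewrite -W //; apply: ae_eq_Rintegral => //; try (by apply: intg_mul_continuous).
by apply: ae_imp pp' => x h xab; rewrite h.
Qed.

Lemma weak_derivative_add a b u w g h :
  L2 a b u -> L2 a b w -> L2 a b g -> L2 a b h ->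
  is_weak_derivative a b u g -> is_weak_derivative a b w h ->
  is_weak_derivative a b (fun x => u x + w x) (fun x => g x + h x).
Proof.
move=> Lu Lw Lg Lh /weak_derivP[W1 W2] /weak_derivP[W3 W4]; apply/weak_derivP.
have ER (f1 f2 : R -> R[i]) : (fun x => Re (f1 x + f2 x)) = (fun x => Re (f1 x) + Re (f2 x)).
  by apply/funext => x; rewrite ReD.
have EI (f1 f2 : R -> R[i]) : (fun x => Im (f1 x + f2 x)) = (fun x => Im (f1 x) + Im (f2 x)).
  by apply/funext => x; rewrite ImD.
rewrite !ER !EI; split; apply: weak_deriv_add => //; try exact: L2_Re_intg; exact: L2_Im_intg.
Qed.

Lemma weak_derivative_scale a b c u g : L2 a b u -> L2 a b g ->
  is_weak_derivative a b u g ->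
  is_weak_derivative a b (fun x => c%:C * u x) (fun x => c%:C * g x).
Proof.
move=> Lu Lg /weak_derivP[W1 W2]; apply/weak_derivP.
have ER (f1 : R -> R[i]) : (fun x => Re (c%:C * f1 x)) = (fun x => c * Re (f1 x)).
  by apply/funext => x; rewrite ReZ.
have EI (f1 : R -> R[i]) : (fun x => Im (c%:C * f1 x)) = (fun x => c * Im (f1 x)).
  by apply/funext => x; rewrite ImZ.
rewrite !ER !EI; split; apply: weak_deriv_scale => //; try exact: L2_Re_intg; exact: L2_Im_intg.
Qed.

Lemma weak_derivative_aeq a b u w g : L2 a b u -> L2 a b w -> aeq a b u w ->
  is_weak_derivative a b u g -> is_weak_derivative a b w g.
Proof.
move=> Lu Lw uw /weak_derivP[W1 W2]; apply/weak_derivP; split.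
  by apply: weak_deriv_ae_eq W1; [exact: L2_Re_intg|exact: L2_Re_intg|apply: ae_imp uw => x h /h ->].
by apply: weak_deriv_ae_eq W2; [exact: L2_Im_intg|exact: L2_Im_intg|apply: ae_imp uw => x h /h ->].
Qed.

Lemma wderivP a b u : H1 a b u ->
  L2 a b (wderiv a b u) /\ is_weak_derivative a b u (wderiv a b u).
Proof. by move=> [_ [g Lg]]; exact: (xgetPex (fun=> 0) (P := [set g | L2 a b g /\ is_weak_derivative a b u g]) (ex_intro _ g Lg)). Qed.

Lemma wderiv_unique a b u g : a < b -> L2 a b u -> L2 a b g ->
  is_weak_derivative a b u g -> aeq a b (wderiv a b u) g.
Proof.
move=> ab Lu Lg Wg; have [Ld Wd] : L2 a b (wderiv a b u) /\ is_weak_derivative a b u (wderiv a b u).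
  by apply: wderivP; split => //; exists g.
move: Wg Wd => /weak_derivP[W1 W2] /weak_derivP[W3 W4].
have E1 := weak_deriv_unique _ _ _ _ _ ab (L2_Re_intg _ _ _ Lu) (L2_Re_intg _ _ _ Ld) (L2_Re_intg _ _ _ Lg) W3 W1.
have E2 := weak_deriv_unique _ _ _ _ _ ab (L2_Im_intg _ _ _ Lu) (L2_Im_intg _ _ _ Ld) (L2_Im_intg _ _ _ Lg) W4 W2.
by apply: ae_imp2 E1 E2 => x h1 h2 xab; apply: eq_ReIm; [exact: h1|exact: h2].
Qed.

Lemma H1_add a b u w : H1 a b u -> H1 a b w -> H1 a b (fun x => u x + w x).
Proof.
move=> [Lu [g [Lg Wg]]] [Lw [h [Lh Wh]]]; split; first exact: L2_add.
by exists (fun x => g x + h x); split; [exact: L2_add|exact: weak_derivative_add].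
Qed.

Lemma H1_scale a b c u : H1 a b u -> H1 a b (fun x => c%:C * u x).
Proof.
move=> [Lu [g [Lg Wg]]]; split; first exact: L2_scale.
by exists (fun x => c%:C * g x); split; [exact: L2_scale|exact: weak_derivative_scale].
Qed.

Lemma wderiv_add a b u w : a < b -> H1 a b u -> H1 a b w ->
  aeq a b (wderiv a b (fun x => u x + w x)) (fun x => wderiv a b u x + wderiv a b w x).
Proof.
move=> ab Hu Hw; have [Lg Wg] := wderivP _ _ _ Hu; have [Lh Wh] := wderivP _ _ _ Hw.
case: Hu => Lu _; case: Hw => Lw _.
by apply: wderiv_unique => //; [exact: L2_add|exact: L2_add|exact: weak_derivative_add].
Qed.

Lemma wderiv_scale a b c u : a < b -> H1 a b u ->
  aeq a b (wderiv a b (fun x => c%:C * u x)) (fun x => c%:C * wderiv a b u x).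
Proof.
move=> ab Hu; have [Lg Wg] := wderivP _ _ _ Hu; case: Hu => Lu _.
by apply: wderiv_unique => //; [exact: L2_scale|exact: L2_scale|exact: weak_derivative_scale].
Qed.

Lemma wderiv_aeq a b u w : a < b -> H1 a b u -> L2 a b w -> aeq a b u w ->
  aeq a b (wderiv a b u) (wderiv a b w).
Proof.
move=> ab Hu Lw uw; have [Lg Wg] := wderivP _ _ _ Hu; case: Hu => Lu _.
apply: aeq_sym; apply: wderiv_unique => //; exact: weak_derivative_aeq Wg.
Qed.

(** [weak_deriv_primitive] provides a continuous representative, so the default value in [trace] is
    never taken. Whatever representative is chosen then equals that primitive at every point of
    [[a, b]], hence is absolutely continuous with derivative [wderiv]. *)
Lemma H1_trace a b u : a < b -> H1 a b u ->
  [/\ {within `[a, b], continuous (trace a b u : R -> R[i]^o)},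
      aeq a b u (trace a b u),
      AC a b (fun x => Re (trace a b u x)) (fun x => Re (wderiv a b u x)) &
      AC a b (fun x => Im (trace a b u x)) (fun x => Im (wderiv a b u x))].
Proof.
move=> ab Hu; have [Lg /weak_derivP[W1 W2]] := wderivP _ _ _ Hu; case: Hu => Lu _.
have [c1 E1] := weak_deriv_primitive _ _ _ _ (L2_Re_intg _ _ _ Lu) (L2_Re_intg _ _ _ Lg) W1.
have [c2 E2] := weak_deriv_primitive _ _ _ _ (L2_Im_intg _ _ _ Lu) (L2_Im_intg _ _ _ Lg) W2.
have I1 := intg_oo_cc _ _ _ (L2_Re_intg _ _ _ Lg); have I2 := intg_oo_cc _ _ _ (L2_Im_intg _ _ _ Lg).
have cc c (g : R -> R) : mu.-integrable `[a, b] (EFin \o g) -> {within `[a, b], continuous (fun x => c + prim a g x)}.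
  by move=> Ig x; apply: cvgD; [exact: cvg_cst|apply: prim_continuous => //; exact: ltW].
have [ct et] : {within `[a, b], continuous (trace a b u : R -> R[i]^o)} /\ aeq a b u (trace a b u).
  apply: (xgetPex u (P := [set w : R -> R[i] | {within `[a, b], continuous (w : R -> R[i]^o)} /\ aeq a b u w])).
  exists (fun x => (c1 + prim a (fun x => Re (wderiv a b u x)) x) +i* (c2 + prim a (fun x => Im (wderiv a b u x)) x)).
  split; first by apply/within_complexP; split; exact: cc.
  by apply: ae_imp2 E1 E2 => x h1 h2 xab; apply: eq_ReIm; [exact: h1|exact: h2].
have p0 (g : R -> R) : prim a g a = 0 by rewrite /prim set_itv1 Rintegral_set1.
have aa : a <= a <= b by rewrite lexx ltW.
split => //; have /within_complexP[cr ci] := ct.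
- split => // x xab.
  have E y : a <= y <= b -> Re (trace a b u y) = c1 + prim a (fun x => Re (wderiv a b u x)) y.
    move=> yab; apply: (within_continuous_ae_eq a b (fun x => Re (trace a b u x))
      (fun x => c1 + prim a (fun x => Re (wderiv a b u x)) x)) => //; first exact: cc.
    by apply: ae_imp2 et E1 => z h1 h2 zab; rewrite -h1 // h2.
  by rewrite (E x xab) (E a aa) p0 addr0.
- split => // x xab.
  have E y : a <= y <= b -> Im (trace a b u y) = c2 + prim a (fun x => Im (wderiv a b u x)) y.
    move=> yab; apply: (within_continuous_ae_eq a b (fun x => Im (trace a b u x))
      (fun x => c2 + prim a (fun x => Im (wderiv a b u x)) x)) => //; first exact: cc.
    by apply: ae_imp2 et E2 => z h1 h2 zab; rewrite -h1 // h2.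
  by rewrite (E x xab) (E a aa) p0 addr0.
Qed.

Lemma trace_unique a b u w : a < b -> H1 a b u ->
  {within `[a, b], continuous (w : R -> R[i]^o)} -> aeq a b u w ->
  forall x, a <= x <= b -> trace a b u x = w x.
Proof.
move=> ab Hu cw uw x xab; have [/within_complexP[c1 c2] e _ _] := H1_trace _ _ _ ab Hu.
move/within_complexP: cw => [c3 c4].
apply: eq_ReIm.
  apply: (within_continuous_ae_eq a b (fun x => Re (trace a b u x)) (fun x => Re (w x))) => //.
  by apply: ae_imp2 e uw => y h1 h2 yab; rewrite -h1 // h2.
apply: (within_continuous_ae_eq a b (fun x => Im (trace a b u x)) (fun x => Im (w x))) => //.
by apply: ae_imp2 e uw => y h1 h2 yab; rewrite -h1 // h2.
Qed.

Lemma trace_add a b u w x : a < b -> H1 a b u -> H1 a b w -> a <= x <= b ->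
  trace a b (fun x => u x + w x) x = trace a b u x + trace a b w x.
Proof.
move=> ab Hu Hw; have [c1 e1 _ _] := H1_trace _ _ _ ab Hu; have [c2 e2 _ _] := H1_trace _ _ _ ab Hw.
apply: (trace_unique a b _ (fun x => trace a b u x + trace a b w x) ab (H1_add _ _ _ _ Hu Hw)).
  move/within_complexP: c1 => [r1 i1]; move/within_complexP: c2 => [r2 i2].
  apply/within_complexP; split.
    rewrite (_ : (fun x => _) = (fun x => Re (trace a b u x) + Re (trace a b w x))).
      by move=> y; apply: cvgD; [exact: r1|exact: r2].
    by apply/funext => y; rewrite ReD.
  rewrite (_ : (fun x => _) = (fun x => Im (trace a b u x) + Im (trace a b w x))).
    by move=> y; apply: cvgD; [exact: i1|exact: i2].
  by apply/funext => y; rewrite ImD.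
by apply: ae_imp2 e1 e2 => y h1 h2 yab; rewrite h1 // h2.
Qed.

Lemma trace_scale a b c u x : a < b -> H1 a b u -> a <= x <= b ->
  trace a b (fun x => c%:C * u x) x = c%:C * trace a b u x.
Proof.
move=> ab Hu; have [c1 e1 _ _] := H1_trace _ _ _ ab Hu.
apply: (trace_unique a b _ (fun x => c%:C * trace a b u x) ab (H1_scale _ _ c _ Hu)).
  move/within_complexP: c1 => [r1 i1].
  apply/within_complexP; split.
    rewrite (_ : (fun x => _) = (fun x => c * Re (trace a b u x))).
      by move=> y; apply: cvgMr; exact: r1.
    by apply/funext => y; rewrite ReZ.
  rewrite (_ : (fun x => _) = (fun x => c * Im (trace a b u x))).
    by move=> y; apply: cvgMr; exact: i1.
  by apply/funext => y; rewrite ImZ.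
by apply: ae_imp e1 => y h1 yab; rewrite h1.
Qed.

End H1Theory.

(** * The Lyapunov form on one interval *)

Section IntervalForm.
Context {R : realType}.
Local Notation mu := (@lebesgue_measure R).
Local Notation Re := complex.Re.
Local Notation Im := complex.Im.
Implicit Types (f g v p : R -> R[i]) (a b c x y r e L : R).

(** The real inner product [Re (z * conj w)] of the complex plane. *)
Definition dotc (z w : R[i]) : R := Re z * Re w + Im z * Im w.

(* With [e = 0] this is the energy density; [(v, p)] stands for [(u_t, u_x)]. *)
Definition form_density r e L x (v p v' p' : R[i]) : R :=
  dotc v v' + r * dotc p p' - e * (L - x) * (dotc v p' + dotc p v').

(** Kept in polarised form: along a solution, half the derivative of the quadratic functional is the
    value on the pair formed by the solution and its image under the generator. *)
Definition interval_form a b r e L v p v' p' : R :=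
  \int[mu]_(x in `]a, b[) form_density r e L x (v x) (p x) (v' x) (p' x).

Lemma dotc_intg a b f g : L2 a b f -> L2 a b g ->
  mu.-integrable `]a, b[ (EFin \o (fun x => dotc (f x) (g x))).
Proof.
by move=> /L2P[f1 f2] /L2P[g1 g2]; apply: intgD => //; exact: sqintegrable_mul.
Qed.

Lemma form_density_intg a b r e L v p v' p' : L2 a b v -> L2 a b p -> L2 a b v' -> L2 a b p' ->
  mu.-integrable `]a, b[ (EFin \o (fun x => form_density r e L x (v x) (p x) (v' x) (p' x))).
Proof.
move=> Lv Lp Lv' Lp'; apply: intgB => //.
  by apply: intgD => //; [exact: dotc_intg|apply: intgZ => //; exact: dotc_intg].
rewrite (_ : (fun x => _) = (fun x => (dotc (v x) (p' x) + dotc (p x) (v' x)) * (e * (L - x)))).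
  apply: intg_mul_continuous; last by apply: intgD => //; exact: dotc_intg.
  by move=> x; apply: cvgMr; apply: cvgB; [exact: cvg_cst|exact: cvg_id].
by apply/funext => x; rewrite mulrC.
Qed.

Lemma interval_form_ae a b r e L v p v' p' w q w' q' :
  L2 a b v -> L2 a b p -> L2 a b v' -> L2 a b p' ->
  L2 a b w -> L2 a b q -> L2 a b w' -> L2 a b q' ->
  aeq a b v w -> aeq a b p q -> aeq a b v' w' -> aeq a b p' q' ->
  interval_form a b r e L v p v' p' = interval_form a b r e L w q w' q'.
Proof.
move=> ? ? ? ? ? ? ? ? E1 E2 E3 E4; apply: ae_eq_Rintegral => //; try exact: form_density_intg.
suff : {ae mu, forall x, `]a, b[%classic x -> v x = w x /\ p x = q x} /\
       {ae mu, forall x, `]a, b[%classic x -> v' x = w' x /\ p' x = q' x}.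
  by case; apply: ae_imp2 => x h1 h2 xab; have [-> ->] := h1 xab; have [-> ->] := h2 xab.
by split; [apply: (ae_imp2 _ _ _ _ E1 E2)|apply: (ae_imp2 _ _ _ _ E3 E4)] => x h1 h2 xab;
  rewrite h1 // h2.
Qed.

Lemma interval_formC a b r e L v p v' p' : interval_form a b r e L v p v' p' = interval_form a b r e L v' p' v p.
Proof. by apply: eq_Rintegral => x _; rewrite /form_density /dotc; ring. Qed.

Lemma interval_formD a b r e L v p w q v' p' : L2 a b v -> L2 a b p -> L2 a b w -> L2 a b q ->
  L2 a b v' -> L2 a b p' ->
  interval_form a b r e L (fun x => v x + w x) (fun x => p x + q x) v' p' =
  interval_form a b r e L v p v' p' + interval_form a b r e L w q v' p'.
Proof.
move=> *; rewrite /interval_form -RintegralD //; try exact: form_density_intg.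
by apply: eq_Rintegral => x _; rewrite /form_density /dotc !ReD !ImD; ring.
Qed.

Lemma interval_formZ a b r e L c v p v' p' : L2 a b v -> L2 a b p -> L2 a b v' -> L2 a b p' ->
  interval_form a b r e L (fun x => c%:C * v x) (fun x => c%:C * p x) v' p' =
  c * interval_form a b r e L v p v' p'.
Proof.
move=> *; rewrite /interval_form -RintegralZl //; try exact: form_density_intg.
by apply: eq_Rintegral => x _; rewrite /form_density /dotc !ReZ !ImZ; ring.
Qed.

Lemma interval_form_energy a b r L v p :
  interval_form a b r 0 L v p v p = \int[mu]_(x in `]a, b[) (sqnormc (v x) + r * sqnormc (p x)).
Proof. by apply: eq_Rintegral => x _; rewrite !sqnormcE /form_density /dotc; ring. Qed.

(** With [k = e * (L - x)], the cross term [2 k Re (v conj p)] is at most [k (|v|^2 + |p|^2)], hence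
    at most half of [|v|^2 + r |p|^2]. The density therefore lies between one half and three halves
    of the energy density. *)
Lemma interval_form_bounds a b r e L v p : 0 < r -> 0 <= e ->
  L2 a b v -> L2 a b p ->
  (forall x, a < x < b -> 0 <= L - x /\ 2 * (e * (L - x)) <= Num.min 1 r) ->
  interval_form a b r 0 L v p v p <= 2 * interval_form a b r e L v p v p /\
  interval_form a b r e L v p v p <= 2 * interval_form a b r 0 L v p v p.
Proof.
move=> r0 e0 Lv Lp H.
have K x : a < x < b -> 0 <= e * (L - x) /\ (2 * (e * (L - x)) <= 1 /\ 2 * (e * (L - x)) <= r).
  move=> /H[h1]; rewrite le_min => /andP[h2 h3]; split => //; exact: mulr_ge0.
have key (k A B X : R) : 0 <= k -> 2 * k <= 1 -> 2 * k <= r -> 0 <= A -> 0 <= B ->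
   2 * X <= A + B -> - (A + B) <= 2 * X ->
   A + r * B <= 2 * (A + r * B - k * (X + X)) /\ A + r * B - k * (X + X) <= 2 * (A + r * B).
  move=> k0 k1 k2 A0 B0 h1 h2.
  have : 2 * k * A <= A by rewrite -[X in _ <= X]mul1r ler_wpM2r.
  have : 2 * k * B <= r * B by rewrite ler_wpM2r.
  have : k * (2 * X) <= k * (A + B) by rewrite ler_wpM2l.
  have : k * (- (A + B)) <= k * (2 * X) by rewrite ler_wpM2l.
  by move: (k * X) => kX; split; lra.
have key' x : a < x < b -> form_density r 0 L x (v x) (p x) (v x) (p x) <= 2 * form_density r e L x (v x) (p x) (v x) (p x) /\
   form_density r e L x (v x) (p x) (v x) (p x) <= 2 * form_density r 0 L x (v x) (p x) (v x) (p x).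
  move=> /K[k0 [k1 k2]].
  have := key (e * (L - x)) (dotc (v x) (v x)) (dotc (p x) (p x)) (dotc (v x) (p x)) k0 k1 k2.
  rewrite /form_density /dotc !mul0r !subr0.
  move: (Re (v x)) (Im (v x)) (Re (p x)) (Im (p x)) => v1 v2 p1 p2 /(_ _ _ _ _).
  have -> : p1 * v1 + p2 * v2 = v1 * p1 + v2 * p2 by ring.
  have := (sqr_ge0 (v1 - p1), sqr_ge0 (v2 - p2), sqr_ge0 (v1 + p1), sqr_ge0 (v2 + p2)).
  by rewrite !expr2 => -[[[? ?] ?] ?]; apply; rewrite ?addr_ge0 -?expr2 ?sqr_ge0 // ?expr2; lra.
rewrite /interval_form -!RintegralZl //; try exact: form_density_intg.
split; apply: le_Rintegral => //; try exact: form_density_intg; try (by apply: intgZ => //; exact: form_density_intg).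
  by move=> x /=; rewrite in_itv /= => /key'[].
by move=> x /=; rewrite in_itv /= => /key'[].
Qed.

(** In the variables [(v, p)] the generator is [(r p', v')]. The integrand becomes [(r Re (p conj
    v))' - e / 2 * (L - x) * (|v|^2 + r |p|^2)'], that is [T'] minus [e / 2] times the energy
    density, which appears when the derivative falls on [L - x]. *)
Lemma interval_form_generator a b r e L v p : a < b -> H1 a b v -> H1 a b p ->
  let T x := r * dotc (trace a b p x) (trace a b v x) -
    e / 2 * (L - x) * (dotc (trace a b v x) (trace a b v x) + r * dotc (trace a b p x) (trace a b p x)) in
  interval_form a b r e L v p (fun x => r%:C * wderiv a b p x) (wderiv a b v) =
  T b - T a - e / 2 * interval_form a b r 0 L v p v p.
Proof.
move=> ab Hv Hp T.
have [_ ev Av1 Av2] := H1_trace _ _ _ ab Hv; have [_ ep Ap1 Ap2] := H1_trace _ _ _ ab Hp.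
have [Ldv _] := wderivP _ _ _ Hv; have [Ldp _] := wderivP _ _ _ Hp.
have Lv := Hv.1; have Lp := Hp.1.
have ab' := ltW ab.
have mul := fun (f1 f2 g1 g2 : R -> R) => @AC_mul R a b f1 f2 g1 g2 ab'.
have add := @AC_add R a b.
have cst c := @AC_cst R a b c.
(* [A1], [A2] and [A3] are the factors [r Re (p conj v)], [- e / 2 * (L - x)] and [|v|^2 + r |p|^2]
   of [T], built from the traces, each with its a.e. derivative. *)
have A1 := mul _ _ _ _ (cst r) (add _ _ _ _ (mul _ _ _ _ Ap1 Av1) (mul _ _ _ _ Ap2 Av2)).
have A2 := mul _ _ _ _ (cst (- (e / 2))) (add _ _ _ _ (cst L) (mul _ _ _ _ (cst (-1)) (@AC_id R a b))).
have A3 := add _ _ _ _ (add _ _ _ _ (mul _ _ _ _ Av1 Av1) (mul _ _ _ _ Av2 Av2))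
   (mul _ _ _ _ (cst r) (add _ _ _ _ (mul _ _ _ _ Ap1 Ap1) (mul _ _ _ _ Ap2 Ap2))).
have A := add _ _ _ _ A1 (mul _ _ _ _ A2 A3).
have E := AC_int _ _ _ _ ab' A; case: A => I _.
move: E I; set T' := (T' in Rintegral _ _ T' = _) => E I.
have -> : T b - T a = \int[mu]_(x in `]a, b[) T' x.
  rewrite Rintegral_oo_cc; last by apply: integrableS I => //; exact: subset_itv_oo_cc.
  by rewrite E /T /dotc /= /id; ring.
rewrite /interval_form -RintegralZl //; last exact: form_density_intg.
rewrite -RintegralB //; last first.
- by apply: intgZ => //; exact: form_density_intg.
- by apply: integrableS I => //; exact: subset_itv_oo_cc.
apply: ae_eq_Rintegral => //.
- by apply: form_density_intg => //; exact: L2_scale.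
- apply: intgB => //; first by apply: integrableS I => //; exact: subset_itv_oo_cc.
  by apply: intgZ => //; exact: form_density_intg.
apply: ae_imp2 ev ep => x h1 h2 xab; rewrite h1 // h2 // /T' /form_density /dotc /= !ReZ !ImZ /id.
by field.
Qed.

End IntervalForm.

(** * Exponential decay of dissipative mild solutions *)

Section Gronwall.
Context {R : realType}.
Implicit Types (phi psi : R -> R).

(** [expR (c * s) * phi s] is nonincreasing. Differentiability is expressed by an estimate over
    nonnegative [s], hence is one-sided at 0, since solutions are only known for nonnegative
    times. *)
Lemma exp_decay_of_derivative phi psi (c : R) :
  (forall t : R, 0 <= t -> forall e : R, 0 < e -> exists2 d : R, 0 < d &
    forall s : R, 0 <= s -> `|s - t| < d -> `|phi s - phi t - (s - t) * psi t| <= e * `|s - t|) ->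
  (forall t : R, 0 <= t -> psi t <= - c * phi t) ->
  forall t : R, 0 <= t -> phi t <= expR (- c * t) * phi 0.
Proof.
move=> D Hpsi t t0.
have [->|tp] := eqVneq t 0; first by rewrite mulr0 expR0 mul1r.
have {}tp : 0 < t by rewrite lt_neqAle eq_sym tp.
pose g s := expR (c * s) * phi s.
have dexp (x : R) : is_derive x 1 (fun s => expR (c * s)) (c * expR (c * x)).
  have h1 : is_derive x 1 (fun s => c * s : R) (c * 1) by exact: is_deriveZ.
  have h2 := is_derive_expR (c * x).
  have := @is_derive1_comp _ expR (fun s => c * s) x _ _ h2 h1.
  by move=> H; apply: (is_derive_eq H); rewrite mulr1 mulrC.
have cexp : continuous (fun s : R => expR (c * s)).
  by move=> x; apply: differentiable_continuous; apply/derivable1_diffP; case: (dexp x).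
have dphi (x : R) : 0 < x -> is_derive x 1 phi (psi x).
  move=> x0.
  have H : h^-1 *: ((phi \o shift x) (h *: 1) - phi x) @[h --> 0^'] --> psi x.
    apply/cvgrPdist_le => e e0; have [d d0 H] := D x (ltW x0) e e0.
    have dx : 0 < Num.min d x by rewrite lt_min d0.
    near=> h.
    have h0 : h != 0 by near: h; exact: nbhs_dnbhs_neq.
    have hn : 0 < `|h| by rewrite normr_gt0.
    have : `|h| < Num.min d x by near: h; exact: dnbhs0_lt.
    rewrite lt_min => /andP[hd hx].
    rewrite /= -(ler_pM2l hn) -normrM mulrBr /GRing.scale /= mulr1 mulVKf //.
    rewrite distrC [_ * e]mulrC.
    have -> : h = (h + x) - x by rewrite addrK.
    have -> : (h + x - x + x) = h + x by rewrite subrK.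
    apply: H; last by rewrite addrK.
    by rewrite -lerBlDr sub0r; move: hx; rewrite ltr_norml => /andP[/ltW].
  apply: DeriveDef; first by apply/cvg_ex; eexists; exact: H.
  by apply/cvg_lim => //; exact: H.
have dg (x : R) : 0 < x -> is_derive x 1 g (expR (c * x) * (psi x + c * phi x)).
  move=> x0; have H := is_deriveM (dexp x) (dphi x x0).
  by apply: (is_derive_eq H); rewrite /GRing.scale /=; ring.
have : g t <= g 0.
  apply: (@ler0_derive1_le_cc _ g 0 t _ _ _ t 0) => //; rewrite ?in_itv /= ?lexx ?t0 //.
  - by move=> x; rewrite in_itv /= => /andP[x0 _]; case: (dg x x0).
  - move=> x; rewrite in_itv /= => /andP[x0 _]; rewrite derive1E.
    have [_ ->] := dg x x0; rewrite mulr_ge0_le0 ?expR_ge0 //.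
    by have := Hpsi x (ltW x0); rewrite mulNr; lra.
  - apply/subspace_continuousP => x; rewrite /= in_itv /= => /andP[x0 xt].
    apply: cvgM.
      by apply: cvg_within_filter; exact: cexp.
    apply/cvgrPdist_le => e e0; rewrite near_withinE.
    (* With tolerance 1 the estimate bounds [|phi y - phi x|] by [(1 + |psi x|) * |y - x|], which
       gives continuity also at the end point 0. *)
    have [d d0 H] := D x x0 1 ltr01.
    have K0 : 0 < 1 + `|psi x| by rewrite ltr_pwDl.
    have dd : 0 < Num.min d (e / (1 + `|psi x|)) by rewrite lt_min d0 divr_gt0.
    exists (Num.min d (e / (1 + `|psi x|))) => // y; rewrite /= lt_min distrC => /andP[yd ye]; rewrite in_itv /= => /andP[y0 _].
    have {}H := H y y0 yd; rewrite distrC.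
    have -> : phi y - phi x = (phi y - phi x - (y - x) * psi x) + (y - x) * psi x by rewrite subrK.
    apply: le_trans (ler_normD _ _) _; rewrite normrM.
    apply: (@le_trans _ _ (`|y - x| * (1 + `|psi x|))); first by rewrite mulrDr mulr1 lerD // -[X in _ <= X]mul1r.
    by rewrite -ler_pdivlMr // ltW.
rewrite /g mulr0 expR0 mul1r => h.
rewrite mulNr expRN ler_pdivlMl ?expR_gt0.
Unshelve. all: by end_near. Qed.
End Gronwall.

Lemma subr_subACA {V : zmodType} (x y z t : V) : x - y - (z - t) = x - z - (y - t).
Proof. by rewrite !opprD addrACA. Qed.

(** Only a seminorm will be available: states are raw functions, and the form does not see null
    sets. It is moreover bilinear only on a subspace [S], because [wderiv] takes a default value
    outside H^1. *)
Definition formN {R : realType} {V : Type} (B : V -> V -> R) (x : V) : R :=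
  Num.sqrt (B x x).

(** * Cauchy-Schwarz and the triangle inequality for a semidefinite form on a subspace *)

Section Dissipative.
Context {R : realType} {V : lmodType R[i]}.
Variables (S : V -> Prop) (B : V -> V -> R).
Hypothesis SD : forall x y, S x -> S y -> S (x + y).
Hypothesis SZ : forall (a : R) x, S x -> S (a%:C *: x).
Hypothesis BD : forall x y z, S x -> S y -> S z -> B (x + y) z = B x z + B y z.
Hypothesis BZ : forall (a : R) x y, S x -> S y -> B (a%:C *: x) y = a * B x y.
Hypothesis BC : forall x y, S x -> S y -> B x y = B y x.
Hypothesis B0 : forall x, S x -> 0 <= B x x.

Local Notation N := (formN B).

Lemma formSN x : S x -> S (- x).
Proof. by move=> Sx; rewrite -scaleN1r -(rmorphN1 (real_complex R)); exact: SZ. Qed.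

Lemma formSB x y : S x -> S y -> S (x - y).
Proof. by move=> Sx Sy; apply: SD => //; exact: formSN. Qed.

Lemma formDr x y z : S x -> S y -> S z -> B z (x + y) = B z x + B z y.
Proof. by move=> Sx Sy Sz; rewrite BC ?BD //; [rewrite !(BC z)|exact: SD]. Qed.

Lemma formZr (a : R) x y : S x -> S y -> B y (a%:C *: x) = a * B y x.
Proof. by move=> Sx Sy; rewrite BC ?BZ //; [rewrite (BC y)|exact: SZ]. Qed.

Lemma form_quad (a : R) x y : S x -> S y ->
  B (x + a%:C *: y) (x + a%:C *: y) = B x x + 2 * a * B x y + a ^+ 2 * B y y.
Proof.
move=> Sx Sy; have Sa := SZ a y Sy; have Sxa := SD _ _ Sx Sa.
by rewrite BD // !formDr // BZ // !formZr // BZ // (BC y x) //; ring.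
Qed.

Lemma form_CS x y : S x -> S y -> `|B x y| <= N x * N y.
Proof.
move=> Sx Sy; rewrite /formN -sqrtrM ?B0 // -sqrtr_sqr ler_wsqrtr //.
have Q a := B0 _ (SD _ _ Sx (SZ a y Sy)); have B0y := B0 y Sy.
have {}Q a : 0 <= B x x + 2 * a * B x y + a ^+ 2 * B y y by rewrite -form_quad.
have [yy|yy] := eqVneq (B y y) 0.
  rewrite yy mulr0; have [->|xy] := eqVneq (B x y) 0; first by rewrite expr0n.
  (* When [B y y = 0] the quadratic is affine in [a]; if [B x y] were nonzero, this [a] would give
     it the value -1. *)
  have := Q (- (B x x + 1) / (2 * B x y)); rewrite yy mulr0 addr0.
  have -> : 2 * (- (B x x + 1) / (2 * B x y)) * B x y = - (B x x + 1) by field.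
  lra.
have y0 : 0 < B y y by rewrite lt_neqAle eq_sym yy.
(* The minimiser of the quadratic in [a]. *)
have := Q (- B x y / B y y).
have -> : B x x + 2 * (- B x y / B y y) * B x y + (- B x y / B y y) ^+ 2 * B y y =
   B x x - B x y ^+ 2 / B y y by field.
by rewrite subr_ge0 ler_pdivrMr.
Qed.

Lemma formN_ge0 x : 0 <= N x. Proof. exact: sqrtr_ge0. Qed.

Lemma formN_sqr x : S x -> N x ^+ 2 = B x x.
Proof. by move=> Sx; rewrite /formN sqr_sqrtr // B0. Qed.

Lemma formN_scale (a : R) x : S x -> N (a%:C *: x) = `|a| * N x.
Proof.
move=> Sx; rewrite /formN BZ //; last exact: SZ.
by rewrite formZr // mulrA -expr2 sqrtrM ?sqr_ge0 // sqrtr_sqr.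
Qed.

Lemma formN_opp x : S x -> N (- x) = N x.
Proof.
move=> Sx; rewrite -scaleN1r -(rmorphN1 (real_complex R)) formN_scale //.
by rewrite normrN1 mul1r.
Qed.

Lemma formN_triangle x y : S x -> S y -> N (x + y) <= N x + N y.
Proof.
move=> Sx Sy; have := form_CS x y Sx Sy; have Nx := formN_ge0 x; have Ny := formN_ge0 y.
have Sxy := SD _ _ Sx Sy.
move=> /(le_trans (ler_norm _)) CS.
rewrite -(@ler_pXn2r _ 2%N) ?nnegrE ?addr_ge0 ?formN_ge0 // formN_sqr //.
have := form_quad 1 x y Sx Sy; rewrite rmorph1 scale1r => ->.
by rewrite sqrrD !formN_sqr // -mulr_natr; lra.
Qed.

Lemma formN_sum n (F : nat -> V) (b : nat -> R) : S 0 ->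
  (forall k, (k < n)%N -> S (F k) /\ N (F k) <= b k) ->
  S (\sum_(k < n) F k) /\ N (\sum_(k < n) F k) <= \sum_(k < n) b k.
Proof.
move=> S00; elim: n => [|n IH] H.
  rewrite !big_ord0; split => //; have -> : (0 : V) = (0 : R)%:C *: 0 by rewrite scaler0.
  by rewrite formN_scale // normr0 mul0r.
have [SI NI] := IH (fun k kn => H k (ltnW kn)); have [Sn Nn] := H n (ltnSn n).
rewrite !big_ord_recr /=; split; first exact: SD.
by apply: (le_trans (formN_triangle _ _ SI Sn)); exact: lerD.
Qed.

End Dissipative.

(** * Increments of the integrated solution, and decay of the solution itself *)

Section MildDecay.
Context {R : realType} {V : lmodType R[i]}.
Variables (S : V -> Prop) (B : V -> V -> R).
Hypothesis SD : forall x y, S x -> S y -> S (x + y).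
Hypothesis SZ : forall (a : R) x, S x -> S (a%:C *: x).
Hypothesis BD : forall x y z, S x -> S y -> S z -> B (x + y) z = B x z + B y z.
Hypothesis BZ : forall (a : R) x y, S x -> S y -> B (a%:C *: x) y = a * B x y.
Hypothesis BC : forall x y, S x -> S y -> B x y = B y x.
Hypothesis B0 : forall x, S x -> 0 <= B x x.

Local Notation N := (formN B).
Let SB := formSB S SD SZ.
Let SN := formSN S SZ.
Let N_ge0 := @formN_ge0 R V B.
Let N_tri := formN_triangle S B SD SZ BD BZ BC B0.
Let N_opp := formN_opp S B SZ BZ BC.
Let N_scale := formN_scale S B SZ BZ BC.
Let N_sqr := formN_sqr S B B0.

Variables (U W : R -> V).
Hypothesis SU : forall t : R, 0 <= t -> S (U t).
Hypothesis SW : forall t : R, 0 <= t -> S (W t).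
Hypothesis Ucont : forall t : R, 0 <= t -> forall e : R, 0 < e -> exists2 d : R, 0 < d &
  forall s : R, 0 <= s -> `|s - t| < d -> N (U s - U t) <= e.
(** Asking for [0 <= xi k] at every index puts all the [U (xi k)] in [S] at once, with no induction
    along the subdivision. *)
Hypothesis Wint : forall t : R, 0 <= t -> forall e : R, 0 < e -> exists2 d : R, 0 < d &
  forall (n : nat) (s xi : nat -> R), s 0%N = 0 -> s n = t -> (forall k, 0 <= xi k) ->
    (forall k, (k < n)%N -> s k <= xi k <= s k.+1 /\ s k.+1 - s k < d) ->
    N (\sum_(k < n) (s k.+1 - s k)%:C *: U (xi k) - W t) <= e.

(* Compare Riemann sums over a subdivision of [0, t + h] containing [t]. *)
Lemma integral_increment (t h e : R) x : 0 <= t -> 0 <= h -> S x ->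
  (forall r, t <= r <= t + h -> N (U r - x) <= e) ->
  N (W (t + h) - W t - h%:C *: x) <= h * e.
Proof.
move=> t0 h0 Sx Ux; have th0 : 0 <= t + h by exact: addr_ge0.
apply/ler_addgt0Pr => e' e'0; have e2 : 0 < e' / 2 by rewrite divr_gt0.
have [d1 d10 H1] := Wint t t0 _ e2; have [d2 d20 H2] := Wint (t + h) th0 _ e2.
pose d := Num.min d1 d2; have d0 : 0 < d by rewrite lt_min d10.
pose n := (Num.truncn ((t + h) / d)).+1.
have nn : (0 : R) < n%:R by rewrite ltr0n.
have nd : (t + h) / n%:R < d.
  by rewrite ltr_pdivrMr // mulrC -ltr_pdivrMr //; exact: truncnS_gt.
(* [n] steps of length [t / n] followed by steps of length [h / n], so that [s n = t] and
   [s (n + n) = t + h]; the truncated subtraction [k - n] counts the latter. The choice of [n] makes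
   both lengths less than [d]. *)
pose s k : R := (minn k n)%:R * (t / n%:R) + (k - n)%N%:R * (h / n%:R).
have dsl k : (k < n)%N -> s k.+1 - s k = t / n%:R.
  move=> kn; rewrite /s !(minn_idPl _) ?(ltnW kn) // (eqP kn) ?subn0.
  have -> : (k - n = 0)%N by apply/eqP; rewrite subn_eq0 ltnW.
  by rewrite -natr1; ring.
have dsr k : s (n + k).+1 - s (n + k)%N = h / n%:R.
  rewrite /s !(minn_idPr _) ?leq_addr //; last by rewrite -addnS leq_addr.
  by rewrite -addnS !addKn -natr1; ring.
have s0 : s 0%N = 0 by rewrite /s min0n sub0n !mul0r addr0.
have sn : s n = t by rewrite /s minnn subnn mul0r addr0 mulrC divfK // gt_eqF.
have snk k : s (n + k)%N = t + k%:R * (h / n%:R).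
  rewrite /s (minn_idPr _) ?leq_addr // addKn; congr (_ + _).
  by rewrite mulrC divfK // gt_eqF.
have s2n : s (n + n)%N = t + h by rewrite snk mulrC divfK // gt_eqF.
have tn0 : 0 <= t / n%:R by rewrite divr_ge0 // ltW.
have hn0 : 0 <= h / n%:R by rewrite divr_ge0 // ltW.
have tnd : t / n%:R < d.
  by apply: le_lt_trans nd; rewrite ler_pM2r ?invr_gt0 // lerDl.
have hnd : h / n%:R < d.
  by apply: le_lt_trans nd; rewrite ler_pM2r ?invr_gt0 // lerDr.
have ds k : 0 <= s k.+1 - s k < d.
  have [kn|nk] := ltnP k n; first by rewrite dsl // tn0.
  by rewrite -(subnKC nk) dsr hn0.
have sub k : s k <= s k <= s k.+1 /\ s k.+1 - s k < d.
  by have /andP[h1 h2] := ds k; rewrite lexx -subr_ge0.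
have sge k : 0 <= s k by rewrite /s addr_ge0 // mulr_ge0.
have {}H1 : N (\sum_(k < n) (s k.+1 - s k)%:C *: U (s k) - W t) <= e' / 2.
  apply: H1 => // k _; have [h1 h2] := sub k; split=> //.
  by apply: (lt_le_trans h2); rewrite ge_min lexx.
have {}H2 : N (\sum_(k < n + n) (s k.+1 - s k)%:C *: U (s k) - W (t + h)) <= e' / 2.
  apply: H2 => // k _; have [h1 h2] := sub k; split=> //.
  by apply: (lt_le_trans h2); rewrite ge_min lexx orbT.
have S00 : S 0 by have := SZ 0 x Sx; rewrite rmorph0 scale0r.
have SSsum m (F : nat -> V) : (forall k, (k < m)%N -> S (F k)) -> S (\sum_(k < m) F k).
  move=> SF; suff [] : S (\sum_(k < m) F k) /\ N (\sum_(k < m) F k) <= \sum_(k < m) N (F k) by [].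
  apply: (formN_sum S B SD SZ BD BZ BC B0 m F (fun k => N (F k))) => // k km.
  by split; [exact: SF|].
have [SS2 NS2] : S (\sum_(k < n) (h / n%:R)%:C *: (U (s (n + k)%N) - x)) /\
    N (\sum_(k < n) (h / n%:R)%:C *: (U (s (n + k)%N) - x)) <= \sum_(k < n) (h / n%:R * e).
  apply: (formN_sum S B SD SZ BD BZ BC B0 n (fun k => (h / n%:R)%:C *: (U (s (n + k)%N) - x)) (fun k => h / n%:R * e)) => // k kn.
  have Sd : S (U (s (n + k)%N) - x) by apply: SB => //; exact: SU.
  split; first exact: SZ.
  rewrite N_scale // ger0_norm // ler_wpM2l // Ux // snk lerDl.
  rewrite mulr_ge0 //= lerD2l mulrCA ler_piMr //.
  by rewrite ler_pdivrMr // mul1r ler_nat ltnW.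
have n0 : n%:R != 0 :> R by rewrite gt_eqF.
have sumE : \sum_(k < n) (h / n%:R * e) = h * e.
  by rewrite sumr_const card_ord -mulr_natr; field.
rewrite {}sumE in NS2.
have E2 : \sum_(k < n) (h / n%:R)%:C *: (U (s (n + k)%N) - x) =
    \sum_(k < n) (s (n + k).+1 - s (n + k)%N)%:C *: U (s (n + k)%N) - h%:C *: x.
  under eq_bigr do rewrite scalerBr.
  rewrite sumrB sumr_const card_ord; congr (_ - _); first by apply: eq_bigr => k _; rewrite dsr.
  by rewrite -scaler_nat scalerA -(rmorph_nat (real_complex R)) -rmorphM /= mulrC divfK // gt_eqF.
rewrite big_split_ord /= in H2.
rewrite {}E2 in SS2 NS2.
move: H1 H2 SS2 NS2; set S1 := \sum_(k < n) _; set S2 := \sum_(k < n) _ => H1 H2 SS2 NS2.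
have SS1 : S S1 by apply: (SSsum n (fun k => (s k.+1 - s k)%:C *: U (s k))) => k _; apply: SZ; exact: SU.
have SS2' : S S2.
  by apply: (SSsum n (fun k => (s (n + k).+1 - s (n + k)%N)%:C *: U (s (n + k)%N))) => k _; apply: SZ; exact: SU.
(* The sum [S1] over [[0, t]] cancels between the two approximations, each accurate to [e' / 2], and
   [S2] is compared with [h x] term by term. *)
have -> : W (t + h) - W t - h%:C *: x =
   - (S1 + S2 - W (t + h)) + ((S1 - W t) + (S2 - h%:C *: x)).
  by rewrite opprB [S1 - _ + _]addrACA [RHS]addrA subrK addrA.
have SA1 : S (S1 + S2 - W (t + h)) by apply: SB; [exact: SD|exact: SW].
have SA2 : S (S1 - W t) by apply: SB => //; exact: SW.
apply: (le_trans (N_tri _ _ (SN _ SA1) (SD _ _ SA2 SS2))); rewrite N_opp //.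
have := N_tri _ _ SA2 SS2; lra.
Qed.

(** The fundamental theorem of calculus in the seminorm. For [s < t] the increment starts at [s] but
    is still compared with [U t]. *)
Lemma integral_derivative (t e : R) : 0 <= t -> 0 < e -> exists2 d : R, 0 < d &
  forall s : R, 0 <= s -> `|s - t| < d ->
    N (W s - W t - (s - t)%:C *: U t) <= e * `|s - t|.
Proof.
move=> t0 e0; have [d d0 H] := Ucont t t0 e e0; exists d => // s s0 st.
have [ts|ts] := leP t s.
  rewrite (ger0_norm (_ : 0 <= s - t)) ?subr_ge0 // mulrC.
  have := integral_increment t (s - t) e (U t) t0; rewrite subr_ge0 subrKC.
  apply => // [|r /andP[tr rs]]; first exact: SU.
  apply: H; first exact: le_trans tr.
  move: st; rewrite !ger0_norm ?subr_ge0 //; lra.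
rewrite ltr0_norm ?subr_lt0 // opprB mulrC.
have := integral_increment s (t - s) e (U t) s0; rewrite subr_ge0 subrKC (ltW ts) => I.
have {}I : N (W t - W s - (t - s)%:C *: U t) <= (t - s) * e.
  apply: I => // [|r /andP[sr rt]]; first exact: SU.
  apply: H; first exact: le_trans sr.
  by rewrite distrC ger0_norm ?subr_ge0 //; move: st; rewrite ltr0_norm ?subr_lt0 //; lra.
suff -> : W s - W t - (s - t)%:C *: U t = - (W t - W s - (t - s)%:C *: U t).
  rewrite N_opp //; apply: SB; last by apply: SZ; exact: SU.
  by apply: SB; exact: SW.
have -> : (t - s)%:C = - (s - t)%:C :> R[i] by rewrite -rmorphN opprB.
by rewrite scaleNr opprK opprD opprB.
Qed.

Variable c : R.
(** [U s - U t] stands for the generator applied to [W s - W t], so this is dissipativity of the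
    generator on the increments. *)
Hypothesis dissip : forall s t : R, 0 <= s -> 0 <= t ->
  B (W s - W t) (U s - U t) <= - c * B (W s - W t) (W s - W t).

Lemma increment_decay (h t : R) : 0 <= h -> 0 <= t ->
  N (W (t + h) - W t) <= expR (- c * t) * N (W h - W 0).
Proof.
move=> h0 t0.
pose y s := W (s + h) - W s; pose z s := U (s + h) - U s.
have Sy s : 0 <= s -> S (y s) by move=> s0; apply: SB; apply: SW; rewrite ?addr_ge0.
have Sz s : 0 <= s -> S (z s) by move=> s0; apply: SB; apply: SU; rewrite ?addr_ge0.
have D : B (y t) (y t) <= expR (- (2 * c) * t) * B (y 0) (y 0).
  apply: (exp_decay_of_derivative (fun s => B (y s) (y s)) (fun s => 2 * B (y s) (z s))) => //.
    move=> {t0}t t0 e e0.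
    (* Write [y s = y t + (s - t) z t + r]. The remainder [r] joins two errors of
       [integral_derivative], whence [e1 / 2]. The bound [e1 <= e / (4 M)] makes [2 |B (y t) r|] at
       most [e / 2 * |s - t|]; [e1 <= 1] and [d3] make the quadratic term at most
       [e / 4 * |s - t|]. *)
    pose M := 1 + N (y t) + N (z t).
    have M0 : 0 < M by rewrite /M; have := N_ge0 (y t); have := N_ge0 (z t); lra.
    pose e1 := Num.min 1 (e / (4 * M)).
    have e10 : 0 < e1 by rewrite lt_min ltr01 divr_gt0 // mulr_gt0.
    have e12 : 0 < e1 / 2 by rewrite divr_gt0.
    have [d1 d10 H1] := integral_derivative t _ t0 e12.
    have [d2 d20 H2] := integral_derivative (t + h) _ (addr_ge0 t0 h0) e12.
    pose d3 := e / (4 * M ^+ 2).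
    have d30 : 0 < d3 by rewrite divr_gt0 // mulr_gt0 // exprn_gt0.
    exists (Num.min (Num.min d1 d2) d3); first by rewrite !lt_min d10 d20.
    move=> s s0; rewrite !lt_min => /andP[/andP[sd1 sd2] sd3].
    have st : s + h - (t + h) = s - t by rewrite opprD addrACA subrr addr0.
    have {}H1 := H1 s s0 sd1.
    have {}H2 : N (W (s + h) - W (t + h) - (s - t)%:C *: U (t + h)) <= e1 / 2 * `|s - t|.
      by rewrite -st; apply: H2; rewrite ?addr_ge0 ?st.
    pose r := y s - y t - (s - t)%:C *: z t.
    have Sq a b u v : 0 <= a -> 0 <= b -> 0 <= u -> S (W a - W b - v%:C *: U u).
      by move=> *; apply: SB; [apply: SB; exact: SW|apply: SZ; exact: SU].
    have Nr : N r <= e1 * `|s - t|.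
      have -> : r = (W (s + h) - W (t + h) - (s - t)%:C *: U (t + h)) + - (W s - W t - (s - t)%:C *: U t).
        rewrite /r /y /z scalerBr [RHS]subr_subACA; congr (_ - _); exact: subr_subACA.
      apply: (le_trans (N_tri _ _ _ _)).
      - by apply: Sq; rewrite ?addr_ge0.
      - by apply: SN; apply: Sq.
      - rewrite N_opp; last exact: Sq.
        lra.
    have Sr : S r by apply: SB; [apply: SB; exact: Sy|apply: SZ; exact: Sz].
    have Sw : S ((s - t)%:C *: z t) by apply: SZ; exact: Sz.
    have Nw : N ((s - t)%:C *: z t) = `|s - t| * N (z t) by apply: N_scale; exact: Sz.
    have ys : y s = y t + (1 : R)%:C *: ((s - t)%:C *: z t + r).
      by rewrite rmorph1 scale1r /r [X in y t + X]addrC subrK addrC subrK.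
    have Swr : S ((s - t)%:C *: z t + r) by exact: SD.
    rewrite ys (form_quad S B SD SZ BD BZ BC 1 (y t) _ (Sy _ t0) Swr).
    have Bwr : B (y t) ((s - t)%:C *: z t + r) = (s - t) * B (y t) (z t) + B (y t) r.
      rewrite (formDr S B SD BD BC _ _ (y t) Sw Sr (Sy _ t0)).
      by rewrite (formZr S B SZ BZ BC _ _ _ (Sz _ t0) (Sy _ t0)).
    rewrite Bwr expr1n !mul1r mulr1 -(N_sqr _ Swr).
    have T1 := form_CS S B SD SZ BD BZ BC B0 (y t) r (Sy _ t0) Sr.
    have T2 := N_tri _ _ Sw Sr; rewrite Nw in T2.
    have Ny := N_ge0 (y t); have Nz := N_ge0 (z t); have Dge := normr_ge0 (s - t).
    have e1M : M * e1 <= e / 4.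
      rewrite mulrC -ler_pdivlMr // ge_min; apply/orP; right.
      by rewrite invfM mulrA lexx.
    have d3M : `|s - t| * M ^+ 2 <= e / 4.
      rewrite -ler_pdivlMr ?exprn_gt0 //; apply/ltW/(lt_le_trans sd3).
      by rewrite /d3 invfM mulrA lexx.
    have e1le : e1 <= 1 by rewrite ge_min lexx.
    have A3 : N ((s - t)%:C *: z t + r) <= `|s - t| * M.
      apply: (le_trans T2); rewrite -/(N r).
      have : e1 * `|s - t| <= 1 * `|s - t| by rewrite ler_wpM2r.
      have : 0 <= `|s - t| * N (y t) by rewrite mulr_ge0.
      by move: Nr; rewrite /M !mulrDr; lra.
    have A4 : N ((s - t)%:C *: z t + r) ^+ 2 <= `|s - t| * (e / 4).
      apply: (@le_trans _ _ ((`|s - t| * M) ^+ 2)).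
        by rewrite ler_pXn2r // ?nnegrE ?mulr_ge0 ?N_ge0 // ltW.
      by rewrite exprMn expr2 -mulrA ler_wpM2l.
    have A5 : `|B (y t) r| <= `|s - t| * (e / 4).
      apply: (le_trans T1); apply: (@le_trans _ _ (M * (e1 * `|s - t|))).
        by apply: ler_pM; rewrite ?N_ge0 // /M; lra.
      by rewrite mulrA mulrC ler_wpM2l.
    have A6 := sqr_ge0 (N ((s - t)%:C *: z t + r)).
    move: A4 A5 A6; rewrite !ler_norml.
    move: (N _ ^+ 2) (B (y t) r) (B (y t) (z t)) (B (y t) (y t)) => q p k m A4 /andP[A5 A5'] A6.
    have := mulr_ge0 Dge (ltW e0).
    have -> : e * `|s - t| = `|s - t| * e by rewrite mulrC.
    by move=> De; apply/andP; split; lra.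
  move=> s s0; have := dissip (s + h) s (addr_ge0 s0 h0) s0.
  by rewrite -/(y s) -/(z s); lra.
have y0E : y 0 = W h - W 0 by rewrite /y add0r.
rewrite -/(y t) -y0E -(@ler_pXn2r _ 2%N) ?nnegrE ?mulr_ge0 ?N_ge0 ?expR_ge0 //.
have [Syt Sy0] := (Sy t t0, Sy 0 (lexx _)).
rewrite exprMn (N_sqr _ Syt) (N_sqr _ Sy0); apply: (le_trans D).
apply: ler_wpM2r; first exact: B0.
by rewrite expr2 -expRD; rewrite le_eqVlt; apply/orP; left; apply/eqP; congr expR; ring.
Qed.

(* Divide [increment_decay] by [h] and let [h] tend to 0. *)
Lemma mild_decay (t : R) : 0 <= t -> N (U t) <= expR (- c * t) * N (U 0).
Proof.
move=> t0; apply/ler_addgt0Pr => e e0.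
pose k := expR (- c * t); have k0 : 0 < k by exact: expR_gt0.
have k1 : 0 < 1 + k by rewrite addr_gt0.
(* Replacing the increments by [h U t] and [h U 0] costs [e1 h] and [k e1 h], which add up to
   [e h]. *)
pose e1 := e / (1 + k); have e10 : 0 < e1 by rewrite divr_gt0.
have [d1 d10 H1] := integral_derivative t e1 t0 e10.
have [d2 d20 H2] := integral_derivative 0 e1 (lexx _) e10.
pose h := Num.min d1 d2 / 2.
have m0 : 0 < Num.min d1 d2 by rewrite lt_min d10.
have h0 : 0 < h by rewrite divr_gt0.
have hm : h < Num.min d1 d2 by rewrite ltr_pdivrMr //; lra.
move: hm; rewrite lt_min => /andP[hd1 hd2].
have {}H1 : N (W (t + h) - W t - h%:C *: U t) <= e1 * h.
  have := H1 (t + h) (addr_ge0 t0 (ltW h0)); rewrite (addrC t) addrK gtr0_norm //; exact.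
have {}H2 : N (W h - W 0 - h%:C *: U 0) <= e1 * h.
  by have := H2 h (ltW h0); rewrite subr0 gtr0_norm //; exact.
have D := increment_decay h t (ltW h0) t0.
have Sh a : 0 <= a -> S (h%:C *: U a) by move=> a0; apply: SZ; exact: SU.
have SWt : S (W (t + h) - W t) by apply: SB; apply: SW; rewrite ?addr_ge0 // ltW.
have SW0 : S (W h - W 0) by apply: SB; apply: SW => //; exact: ltW.
have SE1 : S (W (t + h) - W t - h%:C *: U t) by apply: SB => //; exact: Sh.
have SE2 : S (W h - W 0 - h%:C *: U 0) by apply: SB => //; exact: Sh.
have I1 : h * N (U t) <= N (W (t + h) - W t) + e1 * h.
  rewrite -[X in X * _](gtr0_norm h0) -N_scale; last exact: SU.
  have -> : h%:C *: U t = (W (t + h) - W t) + - (W (t + h) - W t - h%:C *: U t) by rewrite opprB addrC subrK.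
  apply: (le_trans (N_tri _ _ SWt (SN _ SE1))); rewrite N_opp //.
  by rewrite lerD2l.
have I2 : N (W h - W 0) <= h * N (U 0) + e1 * h.
  have -> : W h - W 0 = h%:C *: U 0 + (W h - W 0 - h%:C *: U 0) by rewrite [RHS]addrC subrK.
  apply: (le_trans (N_tri _ _ (Sh 0 (lexx _)) SE2)).
  by rewrite N_scale ?gtr0_norm // ?lerD2l //; exact: SU.
rewrite -(ler_pM2l h0) -/k.
have I3 : k * N (W h - W 0) <= k * (h * N (U 0) + e1 * h) by rewrite ler_pM2l.
have I4 : e1 * h + k * (e1 * h) = h * e by rewrite /e1; field; rewrite gt_eqF.
apply: (le_trans I1); rewrite mulrDr -I4.
have -> : h * (k * N (U 0)) = k * (h * N (U 0)) by ring.
by move: D I3; rewrite -/k mulrDr; lra.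
Qed.

End MildDecay.

(** * The Lyapunov form of the chain *)

Section Differences.
Context {R : realType}.
Implicit Types (u w g : R -> R[i]) (a b c x : R).

Lemma sub_scaleE u w : (fun x => u x - w x) = (fun x => u x + (-1)%:C * w x).
Proof. by apply/funext => x; rewrite rmorphN1 mulN1r. Qed.

Lemma H1_sub a b u w : H1 a b u -> H1 a b w -> H1 a b (fun x => u x - w x).
Proof. by move=> Lu Lw; rewrite sub_scaleE; apply: H1_add => //; exact: H1_scale. Qed.

Lemma wderiv_sub a b u w : a < b -> H1 a b u -> H1 a b w ->
  aeq a b (wderiv a b (fun x => u x - w x)) (fun x => wderiv a b u x - wderiv a b w x).
Proof.
move=> ab Hu Hw; rewrite sub_scaleE (sub_scaleE (wderiv a b u)).
apply: aeq_trans; first by apply: wderiv_add => //; exact: H1_scale.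
by apply: ae_imp (wderiv_scale a b (-1) w ab Hw) => x h /h ->.
Qed.

Lemma trace_sub a b u w x : a < b -> H1 a b u -> H1 a b w -> a <= x <= b ->
  trace a b (fun x => u x - w x) x = trace a b u x - trace a b w x.
Proof.
move=> ab Hu Hw xab; rewrite sub_scaleE trace_add //; last exact: H1_scale.
by rewrite trace_scale // rmorphN1 mulN1r.
Qed.

(** Regroup the sum by nodes: the right end of each interval is paired with the left end of the next
    one, leaving the two outer ends. *)
Lemma le_boundary_sum n (f g : 'I_n -> R) :
  (forall i j : 'I_n, j = i.+1 :> nat -> f i <= g j) ->
  (forall i : 'I_n, i.+1 = n -> f i <= 0) ->
  (forall j : 'I_n, j = 0%N :> nat -> 0 <= g j) ->
  \sum_(j < n) (f j - g j) <= 0.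
Proof.
case: n f g => [|n] f g H1 H2 H3; first by rewrite big_ord0.
rewrite sumrB subr_le0 big_ord_recr /= [X in _ <= X]big_ord_recl /= addrC.
apply: lerD; first by apply: le_trans (H2 _ _) (H3 _ _).
by apply: ler_sum => i _; apply: H1.
Qed.

End Differences.

Section StateForm.
Context {R : realType} {N : nat} (rho : 'I_N -> R).
Hypothesis hrho : forall j : 'I_N, 0 < rho j.
Implicit Types (X Y Z W : state R N) (j : 'I_N) (K : 'I_N -> R).

Local Notation lend := (@lend R N).
Local Notation rend := (@rend R N).

Lemma lend_lt_rend j : lend j < rend j.
Proof. by rewrite ltr_nat. Qed.

Lemma lend_itv j : lend j <= lend j <= rend j.
Proof. by rewrite lexx ltW // lend_lt_rend. Qed.

Lemma rend_itv j : lend j <= rend j <= rend j.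
Proof. by rewrite lexx ltW // lend_lt_rend. Qed.

Lemma inH_L2 X j : inH X -> L2 (lend j) (rend j) (X.2 j).
Proof. by case=> _; exact. Qed.

Lemma inH_H1 X j : inH X -> H1 (lend j) (rend j) (X.1 j).
Proof. by case=> -[+ _ _] _; exact. Qed.

Lemma inH_dx X j : inH X -> L2 (lend j) (rend j) (dx X.1 j).
Proof. by move=> /(inH_H1 _ j) /wderivP[]. Qed.

Lemma inH_add X Y : inH X -> inH Y -> inH (X + Y).
Proof.
move=> HX HY; have [hX1 hX2 hX3] := HX.1; have [hY1 hY2 hY3] := HY.1.
split; last by move=> j; exact: (L2_add _ _ (X.2 j) (Y.2 j) (inH_L2 X j HX) (inH_L2 Y j HY)).
split; first by move=> j; exact: (H1_add _ _ (X.1 j) (Y.1 j) (inH_H1 X j HX) (inH_H1 Y j HY)).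
- move=> j jN; rewrite /rtrace (trace_add _ _ (X.1 j) (Y.1 j) _ (lend_lt_rend j)) ?rend_itv //.
  by rewrite [X in X + _](hX2 j jN) [X in _ + X](hY2 j jN) addr0.
- move=> i j ij; rewrite /rtrace /ltrace.
  rewrite (trace_add _ _ (X.1 i) (Y.1 i) _ (lend_lt_rend i)) ?rend_itv //.
  rewrite (trace_add _ _ (X.1 j) (Y.1 j) _ (lend_lt_rend j)) ?lend_itv //.
  by have := hX3 i j ij; have := hY3 i j ij; rewrite /rtrace /ltrace => -> ->.
Qed.

Lemma inH_scale (a : R) X : inH X -> inH (a%:C *: X).
Proof.
move=> HX; have [hX1 hX2 hX3] := HX.1.
split; last by move=> j; exact: (L2_scale _ _ a (X.2 j) (inH_L2 X j HX)).
split; first by move=> j; exact: (H1_scale _ _ a (X.1 j) (inH_H1 X j HX)).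
- move=> j jN; rewrite /rtrace (trace_scale _ _ a (X.1 j) _ (lend_lt_rend j)) ?rend_itv //.
  by rewrite [X in _ * X](hX2 j jN) mulr0.
- move=> i j ij; rewrite /rtrace /ltrace.
  rewrite (trace_scale _ _ a (X.1 i) _ (lend_lt_rend i)) ?rend_itv //.
  rewrite (trace_scale _ _ a (X.1 j) _ (lend_lt_rend j)) ?lend_itv //.
  by have := hX3 i j ij; rewrite /rtrace /ltrace => ->.
Qed.

Definition chain_form K X Y : R := \sum_(j < N)
  interval_form (lend j) (rend j) (rho j) (K j) N%:R (X.2 j) (dx X.1 j) (Y.2 j) (dx Y.1 j).

Lemma chain_formC K X Y : chain_form K X Y = chain_form K Y X.
Proof. by apply: eq_bigr => j _; exact: interval_formC. Qed.

Lemma chain_formD K X Y Z : inH X -> inH Y -> inH Z ->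
  chain_form K (X + Y) Z = chain_form K X Z + chain_form K Y Z.
Proof.
move=> HX HY HZ; rewrite -big_split; apply: eq_bigr => j _ /=.
have HXY := inH_add _ _ HX HY.
have [LX LdX] := (inH_L2 _ j HX, inH_dx _ j HX).
have [LY LdY] := (inH_L2 _ j HY, inH_dx _ j HY).
have [LZ LdZ] := (inH_L2 _ j HZ, inH_dx _ j HZ).
rewrite -(interval_formD _ _ _ _ _ _ _ _ _ _ _ LX LdX LY LdY LZ LdZ).
exact: (interval_form_ae _ _ _ _ _ _ _ _ _ _ _ _ _ (inH_L2 _ j HXY) (inH_dx _ j HXY) LZ LdZ
  (L2_add _ _ _ _ LX LY) (L2_add _ _ _ _ LdX LdY) LZ LdZ (aeq_refl _ _ _)
  (wderiv_add _ _ _ _ (lend_lt_rend j) (inH_H1 _ j HX) (inH_H1 _ j HY))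
  (aeq_refl _ _ _) (aeq_refl _ _ _)).
Qed.

Lemma chain_formZ K (a : R) X Y : inH X -> inH Y ->
  chain_form K (a%:C *: X) Y = a * chain_form K X Y.
Proof.
move=> HX HY; rewrite mulr_sumr; apply: eq_bigr => j _ /=.
have HaX := inH_scale a _ HX.
have [LX LdX] := (inH_L2 _ j HX, inH_dx _ j HX).
have [LY LdY] := (inH_L2 _ j HY, inH_dx _ j HY).
rewrite -(interval_formZ _ _ _ _ _ a _ _ _ _ LX LdX LY LdY).
exact: (interval_form_ae _ _ _ _ _ _ _ _ _ _ _ _ _ (inH_L2 _ j HaX) (inH_dx _ j HaX) LY LdY
  (L2_scale _ _ a _ LX) (L2_scale _ _ a _ LdX) LY LdY (aeq_refl _ _ _)
  (wderiv_scale _ _ a _ (lend_lt_rend j) (inH_H1 _ j HX))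
  (aeq_refl _ _ _) (aeq_refl _ _ _)).
Qed.

Lemma chain_form_energy X : chain_form (fun=> 0) X X = 2 * energy rho X.
Proof.
rewrite /energy mulrA mulfV ?pnatr_eq0 // mul1r.
by apply: eq_bigr => j _; rewrite interval_form_energy.
Qed.

Lemma normH_formN X : normH rho X = formN (chain_form (fun=> 0)) X.
Proof. by rewrite /formN /normH; congr Num.sqrt; apply: eq_bigr => j _; rewrite interval_form_energy. Qed.

Lemma chain_form0_ge0 X : 0 <= chain_form (fun=> 0) X X.
Proof.
apply: sumr_ge0 => j _; rewrite interval_form_energy; apply: Rintegral_ge0 => x _.
by apply: addr_ge0; [exact: sqr_ge0|apply: mulr_ge0; [exact: ltW|exact: sqr_ge0]].
Qed.

Lemma chain_form_bounds K X : inH X -> (forall j, 0 <= K j) ->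
  (forall j, 2 * (K j * N%:R) <= Num.min 1 (rho j)) ->
  chain_form (fun=> 0) X X <= 2 * chain_form K X X /\
  chain_form K X X <= 2 * chain_form (fun=> 0) X X.
Proof.
move=> HX K0 HK.
have key j := interval_form_bounds (lend j) (rend j) (rho j) (K j) N%:R _ _ (hrho j) (K0 j)
  (inH_L2 _ j HX) (inH_dx _ j HX).
have {}key j : interval_form (lend j) (rend j) (rho j) 0 N%:R (X.2 j) (dx X.1 j) (X.2 j) (dx X.1 j) <=
    2 * interval_form (lend j) (rend j) (rho j) (K j) N%:R (X.2 j) (dx X.1 j) (X.2 j) (dx X.1 j) /\
    interval_form (lend j) (rend j) (rho j) (K j) N%:R (X.2 j) (dx X.1 j) (X.2 j) (dx X.1 j) <=
    2 * interval_form (lend j) (rend j) (rho j) 0 N%:R (X.2 j) (dx X.1 j) (X.2 j) (dx X.1 j).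
  apply: key => x /andP[xl xr].
  have x0 : 0 <= x by rewrite (le_trans _ (ltW xl)) // ler0n.
  have xN : x <= N%:R by rewrite (le_trans (ltW xr)) // ler_nat ltn_ord.
  split; first by rewrite subr_ge0.
  apply: le_trans (HK j); rewrite ler_pM2l // ler_wpM2l //; lra.
by rewrite !mulr_sumr; split; apply: ler_sum => j _; have [] := key j.
Qed.

Lemma eqH_chain_form K X Y : inH X -> inH Y -> eqH X Y -> chain_form K X X = chain_form K Y Y.
Proof.
move=> HX HY XY; apply: eq_bigr => j _; have [e1 e2] := XY j.
have e3 : aeq (lend j) (rend j) (dx X.1 j) (dx Y.1 j).
  exact: (wderiv_aeq _ _ _ _ (lend_lt_rend j) (inH_H1 _ j HX) (inH_H1 _ j HY).1 e1).
have [LX LdX] := (inH_L2 _ j HX, inH_dx _ j HX).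
have [LY LdY] := (inH_L2 _ j HY, inH_dx _ j HY).
exact: (interval_form_ae _ _ _ _ _ _ _ _ _ _ _ _ _ LX LdX LX LdX LY LdY LY LdY e2 e3 e2 e3).
Qed.

End StateForm.

(** * Sign of the boundary terms and dissipativity of the generator *)

Section Dissipation.
Context {R : realType} {N : nat} (rho : 'I_N -> R).
Hypothesis hrho : forall j : 'I_N, 0 < rho j.
Variable K : 'I_N -> R.
Hypothesis Kdec : forall i j : 'I_N, j = i.+1 :> nat ->
  K j <= K i /\ K j * rho i <= K i * rho j.
Hypothesis Kdamp : forall j : 'I_N, j = 0%N :> nat -> K j * N%:R * (1 + (rho j)^-1) <= 2.
Implicit Types (W U : state R N) (i j : 'I_N).
Local Notation lend := (@lend R N).
Local Notation rend := (@rend R N).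

Let T j x (p v : R[i]) := rho j * dotc p v - K j / 2 * (N%:R - x) * (dotc v v + rho j * dotc p p).

Lemma dotc_ge0 (z : R[i]) : 0 <= dotc z z.
Proof. by rewrite /dotc -!expr2 addr_ge0 // sqr_ge0. Qed.

(** At an interface the terms [rho Re (p conj v)] agree on both sides, and
    [K (|v|^2 + |rho p|^2 / rho)] must not increase from left to right; the two parts of [Kdec] are
    its two summands. At [x = 0], substituting [rho p = v] turns the term into [|v|^2] times
    [1 - K N (1 + rho^-1) / 2], which is nonnegative by [Kdamp]. *)
Lemma boundary_dissipative (pl pr vl vr : 'I_N -> R[i]) :
  (forall j, j.+1 = N -> vr j = 0) ->
  (forall i j, j = i.+1 :> nat -> vr i = vl j) ->
  (forall i j, j = i.+1 :> nat -> (rho i)%:C * pr i = (rho j)%:C * pl j) ->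
  (forall j, j = 0%N :> nat -> (rho j)%:C * pl j = vl j) ->
  \sum_(j < N) (T j (rend j) (pr j) (vr j) - T j (lend j) (pl j) (vl j)) <= 0.
Proof.
move=> h1 h2 h3 h4.
apply: (le_boundary_sum N (fun j => T j (rend j) (pr j) (vr j)) (fun j => T j (lend j) (pl j) (vl j))).
- move=> i j ij; have Kij := Kdec i j ij.
  have -> : lend j = rend i by rewrite /lend /rend ij.
  rewrite -(h2 i j ij); have := h3 i j ij.
  have L0 : 0 <= N%:R - rend i by rewrite subr_ge0 ler_nat ltn_ord.
  move: (pr i) (pl j) (vr i) => q q' v E.
  have ri := hrho i; have rj := hrho j.
  have E1 : rho i * dotc q v = rho j * dotc q' v.
    by rewrite /dotc !mulrDr !mulrA -!ReZ -!ImZ E.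
  have E2 : rho i ^+ 2 * dotc q q = rho j ^+ 2 * dotc q' q'.
    transitivity (dotc ((rho i)%:C * q) ((rho i)%:C * q)); first by rewrite /dotc ReZ ImZ; ring.
    by rewrite E /dotc ReZ ImZ; ring.
  have B0 := dotc_ge0 q'; have A0 := dotc_ge0 v.
  have Q : K j * (dotc v v + rho j * dotc q' q') <= K i * (dotc v v + rho i * dotc q q).
    have [Kle Kle'] := Kij; rewrite (mulrDr (K j) (dotc v v)) (mulrDr (K i) (dotc v v)); apply: lerD; first by apply: ler_wpM2r.
    rewrite -(ler_pM2l ri).
    have -> : rho i * (K i * (rho i * dotc q q)) = K i * (rho i ^+ 2 * dotc q q) by ring.
    rewrite E2.
    have -> : rho i * (K j * (rho j * dotc q' q')) = K j * rho i * (rho j * dotc q' q') by ring.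
    have -> : K i * (rho j ^+ 2 * dotc q' q') = K i * rho j * (rho j * dotc q' q') by ring.
    by apply: ler_wpM2r => //; apply: mulr_ge0 => //; exact: ltW.
  rewrite /T E1 lerD2l lerN2.
  have half k X : k / 2 * (N%:R - rend i) * X = (N%:R - rend i) / 2 * (k * X) by ring.
  by rewrite !half; apply: ler_wpM2l => //; exact: divr_ge0.
- move=> j jN; rewrite /T h1 // /rend jN subrr mulr0 mul0r subr0.
  by rewrite /dotc /= !mulr0 addr0 mulr0.
- move=> j j0; rewrite /T -(h4 j j0) /lend j0 subr0.
  have rj := hrho j; move: (Kdamp j j0); move: (pl j) => q H.
  have q0 := dotc_ge0 q.
  have -> : dotc q ((rho j)%:C * q) = rho j * dotc q q by rewrite /dotc ReZ ImZ; ring.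
  have -> : dotc ((rho j)%:C * q) ((rho j)%:C * q) = rho j ^+ 2 * dotc q q by rewrite /dotc ReZ ImZ; ring.
  have -> : rho j * (rho j * dotc q q) - K j / 2 * N%:R * (rho j ^+ 2 * dotc q q + rho j * dotc q q) =
    rho j ^+ 2 * dotc q q * (1 - K j * N%:R * (1 + (rho j)^-1) / 2) by field; rewrite gt_eqF.
  by apply: mulr_ge0; [rewrite mulr_ge0 // sqr_ge0|lra].
Qed.

Variable c : R.
Hypothesis Kc : forall j, c <= K j / 2.

(** [U0] cancels, so [U1 - U2] is a.e. the generator applied to [W1 - W2]. On each interval
    [interval_form_generator] then leaves boundary terms, whose sum is nonpositive, and [- K j / 2]
    times the energy integral. *)
Lemma generator_dissipative W1 W2 U0 U1 U2 : inH W1 -> inH W2 -> inH U0 -> inH U1 -> inH U2 ->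
  inDA rho W1 -> inDA rho W2 -> eqH U1 (U0 + opA rho W1) -> eqH U2 (U0 + opA rho W2) ->
  chain_form rho K (W1 - W2) (U1 - U2) <= - c * chain_form rho (fun=> 0) (W1 - W2) (W1 - W2).
Proof.
move=> HW1 HW2 HU0 HU1 HU2 D1 D2 E1 E2.
pose v j x := W1.2 j x - W2.2 j x.
pose p j x := dx W1.1 j x - dx W2.1 j x.
have Hv1 j : H1 (lend j) (rend j) (W1.2 j) by case: D1 => _ [+ _ _] _ _; exact.
have Hv2 j : H1 (lend j) (rend j) (W2.2 j) by case: D2 => _ [+ _ _] _ _; exact.
have Hp1 j : H1 (lend j) (rend j) (dx W1.1 j) by case: D1 => -[_ H] _ _ _; case: (H j).
have Hp2 j : H1 (lend j) (rend j) (dx W2.1 j) by case: D2 => -[_ H] _ _ _; case: (H j).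
have Hv j : H1 (lend j) (rend j) (v j) by exact: H1_sub.
have Hp j : H1 (lend j) (rend j) (p j) by exact: H1_sub.
have lr j := @lend_lt_rend R N j.
have SW : inH (W1 - W2) by exact: (formSB _ (@inH_add R N) (@inH_scale R N)).
have SU : inH (U1 - U2) by exact: (formSB _ (@inH_add R N) (@inH_scale R N)).
have dW j : aeq (lend j) (rend j) (dx (W1 - W2).1 j) (p j).
  by apply: (wderiv_sub _ _ (W1.1 j) (W2.1 j) (lr j)); exact: inH_H1.
have U1E j : aeq (lend j) (rend j) ((U1 - U2).1 j) (v j).
  have [e1 _] := E1 j; have [e2 _] := E2 j.
  apply: ae_imp2 e1 e2 => x h1 h2 xab; transitivity (U1.1 j x - U2.1 j x); first by [].
  rewrite h1 // h2 // /v.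
  transitivity ((U0.1 j x + W1.2 j x) - (U0.1 j x + W2.2 j x)); first by [].
  by rewrite opprD addrACA subrr add0r.
have dU j : aeq (lend j) (rend j) (dx (U1 - U2).1 j) (wderiv (lend j) (rend j) (v j)).
  exact: (wderiv_aeq _ _ _ _ (lr j) (inH_H1 _ j SU) (Hv j).1 (U1E j)).
have U2E j : aeq (lend j) (rend j) ((U1 - U2).2 j)
    (fun x => (rho j)%:C * wderiv (lend j) (rend j) (p j) x).
  have [_ e1] := E1 j; have [_ e2] := E2 j.
  have e3 := wderiv_sub _ _ _ _ (lr j) (Hp1 j) (Hp2 j).
  have e12 : aeq (lend j) (rend j) ((U1 - U2).2 j)
      (fun x => (rho j)%:C * dx (dx W1.1) j x - (rho j)%:C * dx (dx W2.1) j x).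
    apply: ae_imp2 e1 e2 => x h1 h2 xab; transitivity (U1.2 j x - U2.2 j x); first by [].
    rewrite h1 // h2 //.
    transitivity ((U0.2 j x + (rho j)%:C * dx (dx W1.1) j x) - (U0.2 j x + (rho j)%:C * dx (dx W2.1) j x)); first by [].
    by rewrite opprD addrACA subrr add0r.
  apply: (aeq_trans _ _ _ _ _ e12).
  by apply: ae_imp e3 => x h xab; rewrite /p h // mulrBr.
have Ldp j : L2 (lend j) (rend j) (wderiv (lend j) (rend j) (p j)) by have [] := wderivP _ _ _ (Hp j).
have Ldv j : L2 (lend j) (rend j) (wderiv (lend j) (rend j) (v j)) by have [] := wderivP _ _ _ (Hv j).
have Lv j : L2 (lend j) (rend j) (v j) by case: (Hv j).
have Lp j : L2 (lend j) (rend j) (p j) by case: (Hp j).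
pose E j := interval_form (lend j) (rend j) (rho j) 0 N%:R (v j) (p j) (v j) (p j).
have N0 : chain_form rho (fun=> 0) (W1 - W2) (W1 - W2) = \sum_(j < N) E j.
  apply: eq_bigr => j _; have [LW LdW] := (inH_L2 _ j SW, inH_dx _ j SW).
  exact: (interval_form_ae _ _ _ _ _ _ _ _ _ _ _ _ _ LW LdW LW LdW (Lv j) (Lp j) (Lv j) (Lp j)
    (aeq_refl _ _ _) (dW j) (aeq_refl _ _ _) (dW j)).
pose pl j := trace (lend j) (rend j) (p j) (lend j).
pose pr j := trace (lend j) (rend j) (p j) (rend j).
pose vl j := trace (lend j) (rend j) (v j) (lend j).
pose vr j := trace (lend j) (rend j) (v j) (rend j).
have B0 : chain_form rho K (W1 - W2) (U1 - U2) =
   \sum_(j < N) ((T j (rend j) (pr j) (vr j) - T j (lend j) (pl j) (vl j)) - K j / 2 * E j).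
  apply: eq_bigr => j _.
  have G := interval_form_generator _ _ (rho j) (K j) N%:R _ _ (lr j) (Hv j) (Hp j).
  refine (etrans _ G).
  exact: (interval_form_ae _ _ _ _ _ _ _ _ _ _ _ _ _ (inH_L2 _ j SW) (inH_dx _ j SW)
    (inH_L2 _ j SU) (inH_dx _ j SU) (Lv j) (Lp j) (L2_scale _ _ (rho j) _ (Ldp j)) (Ldv j)
    (aeq_refl _ _ _) (dW j) (U2E j) (dU j)).
have E0 j : 0 <= E j.
  rewrite /E interval_form_energy; apply: Rintegral_ge0 => x _.
  by apply: addr_ge0; [exact: sqr_ge0|apply: mulr_ge0; [exact: ltW|exact: sqr_ge0]].
rewrite N0 B0 sumrB.
have bd : \sum_(j < N) (T j (rend j) (pr j) (vr j) - T j (lend j) (pl j) (vl j)) <= 0.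
  have Tp j x (jx : lend j <= x <= rend j) := trace_sub _ _ _ _ _ (lr j) (Hp1 j) (Hp2 j) jx.
  have Tv j x (jx : lend j <= x <= rend j) := trace_sub _ _ _ _ _ (lr j) (Hv1 j) (Hv2 j) jx.
  have [Tpl Tpr] := (fun j => Tp j _ (lend_itv j), fun j => Tp j _ (rend_itv j)).
  have [Tvl Tvr] := (fun j => Tv j _ (lend_itv j), fun j => Tv j _ (rend_itv j)).
  case: D1 => _ [_ l1 m1] z1 q1; case: D2 => _ [_ l2 m2] z2 q2.
  rewrite /ltrace /rtrace in l1 m1 z1 q1 l2 m2 z2 q2.
  apply: boundary_dissipative.
  - by move=> j jN; rewrite /vr Tvr l1 // l2 // subrr.
  - by move=> i j ij; rewrite /vr /vl Tvr Tvl (m1 _ _ ij) (m2 _ _ ij).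
  - by move=> i j ij; rewrite /pr /pl Tpr Tpl (mulrBr (rho i)%:C) (mulrBr (rho j)%:C) (q1 _ _ ij) (q2 _ _ ij).
  - by move=> j j0; rewrite /pl /vl Tpl Tvl (mulrBr (rho j)%:C) (z1 _ j0) (z2 _ j0).
have : c * \sum_(j < N) E j <= \sum_(j < N) (K j / 2 * E j).
  by rewrite mulr_sumr; apply: ler_sum => j _; rewrite ler_wpM2r.
move=> cE; rewrite mulNr -[X in _ <= X]add0r; exact: lerB bd cE.
Qed.

End Dissipation.

(** * Choice of the weights and conclusion *)

Lemma exists_multiplier_weights (R : realType) (N : nat) (rho : 'I_N -> R) :
  (1 <= N)%N -> (forall j : 'I_N, 0 < rho j) ->
  exists (e : R) (K : 'I_N -> R), [/\ 0 < e, forall j, e <= K j,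
    forall j, 2 * (K j * N%:R) <= Num.min 1 (rho j),
    forall i j : 'I_N, j = i.+1 :> nat -> K j <= K i /\ K j * rho i <= K i * rho j &
    forall j, K j * N%:R * (1 + (rho j)^-1) <= 2].
Proof.
move=> hN hrho.
(* Sums of nonnegative terms serve as upper bounds: [M] dominates 1 and every ratio [rho i / rho j],
   and [s] dominates every [1 + (rho j)^-1]. *)
pose M := 1 + \sum_(i < N) \sum_(j < N) rho i / rho j.
pose s := 1 + \sum_(j < N) (rho j)^-1.
have V0 j : 0 <= (rho j)^-1 by rewrite invr_ge0 ltW.
have D0 i j : 0 <= rho i / rho j by rewrite mulr_ge0 // ltW.
have M1 : 1 <= M by rewrite lerDl; apply: sumr_ge0 => i _; exact: sumr_ge0.
have Mij i j : rho i <= M * rho j.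
  rewrite -ler_pdivrMr // /M (bigD1 i) //= (bigD1 j) //=.
  have h1 : 0 <= \sum_(i0 < N | i0 != j) rho i / rho i0 by exact: sumr_ge0.
  have h2 : 0 <= \sum_(i0 < N | i0 != i) \sum_(j0 < N) rho i0 / rho j0.
    by apply: sumr_ge0 => k _; exact: sumr_ge0.
  move: h1 h2; set x := \sum_(i0 < N | i0 != j) _; set y := \sum_(i0 < N | i0 != i) _; lra.
have sj j : 1 + (rho j)^-1 <= s.
  by rewrite lerD2l (bigD1 j) //= lerDl; exact: sumr_ge0.
have s1 : 1 <= s by rewrite lerDl; exact: sumr_ge0.
have s0 : 0 < s by exact: lt_le_trans s1.
have N0 : (0 : R) < N%:R by rewrite ltr0n.
have M0 : 0 < M by exact: lt_le_trans M1.
have MN0 : 0 < M ^+ N by exact: exprn_gt0.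
(* Normalised so that [2 * (K j * N) * s <= 1], with equality at [j = 0]. Bounding [s] below by 1,
   by [(rho j)^-1] and by [1 + (rho j)^-1] yields all the smallness conditions. *)
pose e := (2 * N%:R * M ^+ N * s)^-1.
have e0 : 0 < e by rewrite invr_gt0 !mulr_gt0.
(* [M] exceeds 1 and all the ratios [rho i / rho j], so this decreases fast enough. *)
pose K (j : 'I_N) := e * M ^+ (N - j).
have K0 j : 0 < K j by rewrite mulr_gt0 // exprn_gt0.
have Ks j : 2 * (K j * N%:R) * s <= 1.
  have KM : K j <= e * M ^+ N.
    by apply: ler_wpM2l; [exact: ltW|apply: ler_weXn2l => //; exact: leq_subr].
  have E : 2 * (e * M ^+ N * N%:R) * s = 1 by rewrite /e; field; rewrite !gt_eqF.
  rewrite -[X in _ <= X]E; apply: ler_wpM2r; first exact: ltW.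
  by apply: ler_wpM2l => //; apply: ler_wpM2r.
have KN0 j : 0 <= K j * N%:R by rewrite mulr_ge0 // ltW.
exists e, K; split => //.
- move=> j; rewrite -[X in X <= _]mulr1; apply: ler_wpM2l; first exact: ltW.
  exact: exprn_ege1.
- move=> j; rewrite le_min; apply/andP; split.
    apply: le_trans (Ks j); rewrite ler_peMr //; exact: mulr_ge0.
  have : 2 * (K j * N%:R) * (rho j)^-1 <= 1.
    apply: le_trans (Ks j); apply: ler_wpM2l; first exact: mulr_ge0.
    by apply: le_trans (sj j); rewrite lerDr.
  by rewrite ler_pdivrMr // mul1r.
- move=> i j ij.
  have -> : K i = M * K j.
    rewrite /K mulrCA -exprS; congr (_ * _ ^+ _).
    by rewrite ij subnSK // -ij.
  split; first by rewrite ler_peMl // ltW.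
  have -> : M * K j * rho j = K j * (M * rho j) by rewrite [RHS]mulrCA mulrA.
  by apply: ler_wpM2l; [exact: ltW|exact: Mij].
- move=> j; apply: (@le_trans _ _ (K j * N%:R * s)); first by apply: ler_wpM2l.
  by have := Ks j; rewrite -mulrA; lra.
Qed.

Theorem theorem3p1 (R : realType) (N : nat) (rho : 'I_N -> R)
    (hN : (1 <= N)%N) (hrho : forall j : 'I_N, 0 < rho j) :
  exists C omega : R, [/\ 0 < C, 0 < omega &
    forall U0 : state R N, inH U0 ->
    forall U : R -> state R N, mild_solution rho U0 U ->
    forall t : R, 0 < t ->
      energy rho (U t) <= C * expR (- omega * t) * normH rho U0 ^+ 2].
Proof.
have [e [K [e0 Ke HK Kdec Kdamp]]] := exists_multiplier_weights _ _ _ hN hrho.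
(* The energy is half the squared norm, hence at most the Lyapunov form at time [t]; the form at
   time 0 is at most twice the squared norm of [U0], whence 2. The generator dissipates [e / 2]
   times the squared norm, thus [e / 4] times the form; the seminorm decays at rate [e / 4] and its
   square at rate [e / 2]. *)
exists 2, (e / 2); split; [by []|by rewrite divr_gt0|].
move=> U0 HU0 U [[SU Uc] U00 mild] t t0.
have K0 j : 0 <= K j by apply: le_trans (Ke j); exact: ltW.
have bnd X (HX : inH X) := chain_form_bounds rho hrho K X HX K0 HK.
have E0 := chain_form0_ge0 rho hrho.
have B0 X : inH X -> 0 <= chain_form rho K X X.
  by move=> /bnd[h _]; have := E0 X; lra.
(* Carries continuity and Riemann sums from the norm of H over to the seminorm of the Lyapunov form;
   the tolerances [d / 2] below absorb the factor 2. *)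
have le_formN X : inH X -> formN (chain_form rho K) X <= 2 * normH rho X.
  move=> HX; rewrite normH_formN -[X in X * _]ger0_norm // -sqrtr_sqr -sqrtrM ?sqr_ge0 //.
  by rewrite ler_wsqrtr //; have [_ h] := bnd X HX; have := E0 X; lra.
have : forall t, exists W, 0 <= t ->
    [/\ is_integralH rho U t W, inDA rho W & eqH (U t) (U0 + opA rho W)].
  (* Choice requires a value at negative times too; [U0] is an arbitrary one. *)
  move=> s; have [s0|s0] := lerP 0 s; last by exists U0.
  by have [W ?] := mild s s0; exists W.
move=> /choice[W HW].
have SW s : 0 <= s -> inH (W s).
  by move=> /HW[_ [[V1 _] [V2 _ _] _ _] _]; split => // j; case: (V2 j).
have D := @mild_decay R (state R N) (@inH R N) (chain_form rho K) (@inH_add R N) (@inH_scale R N)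
  (chain_formD rho K) (chain_formZ rho K) (fun X Y _ _ => chain_formC rho K X Y) B0 U W SU SW.
have Nt : formN (chain_form rho K) (U t) <= expR (- (e / 4) * t) * formN (chain_form rho K) (U 0).
  apply: D; last exact: ltW.
  - move=> s s0 d d0; have d2 : 0 < d / 2 by rewrite divr_gt0.
    have /cvgrPdist_lt/(_ _ d2) := Uc s s0; rewrite near_withinE => -[r /= r0 H].
    exists r => // q q0 qs; have Hq : inH (U q - U s).
      by apply: (formSB _ (@inH_add R N) (@inH_scale R N)); exact: SU.
    apply: (le_trans (le_formN _ Hq)).
    have := H q; rewrite /= distrC => /(_ qs q0); rewrite sub0r normrN.
    by move=> /(le_lt_trans (ler_norm _)); lra.
  - move=> s s0 d d0; have d2 : 0 < d / 2 by rewrite divr_gt0.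
    have [I _ _] := HW s s0; have [r r0 H] := I _ d2.
    exists r => // n sub xi s00 sn xi0 Hsub.
    have SU' k : inH ((sub k.+1 - sub k)%:C *: U (xi k)) by apply: inH_scale; exact: SU.
    have Hq : inH (\sum_(k < n) (sub k.+1 - sub k)%:C *: U (xi k) - W s).
      apply: (formSB _ (@inH_add R N) (@inH_scale R N)); last exact: SW.
      elim: n {sn H Hsub} => [|n IH]; last by rewrite big_ord_recr /=; exact: inH_add.
      rewrite big_ord0; have := inH_scale 0 _ HU0; rewrite rmorph0 scale0r //.
    apply: (le_trans (le_formN _ Hq)).
    by have := H n sub xi s00 sn Hsub; lra.
  - move=> s r s0 r0; have [_ D1 E1] := HW s s0; have [_ D2 E2] := HW r r0.
    have Kc j : e / 2 <= K j / 2 by rewrite ler_pM2r ?invr_gt0.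
    have := generator_dissipative rho hrho K Kdec (fun j _ => Kdamp j) _ Kc _ _ _ _ _
      (SW s s0) (SW r r0) HU0 (SU s s0) (SU r r0) D1 D2 E1 E2.
    have Hq : inH (W s - W r).
      by apply: (formSB _ (@inH_add R N) (@inH_scale R N)); exact: SW.
    have [_ h2] := bnd _ Hq.
    move=> /le_trans; apply; move: (chain_form rho K _ _) (chain_form rho (fun=> 0) _ _) h2 => x y h2.
    by have := ler_wpM2l (ltW e0) h2; lra.
have {Nt} : chain_form rho K (U t) (U t) <= expR (- (e / 2) * t) * chain_form rho K (U 0) (U 0).
  have St := SU t (ltW t0); have S0 := SU 0 (lexx _).
  rewrite -!(formN_sqr inH (chain_form rho K) B0) //.
  have -> : expR (- (e / 2) * t) = expR (- (e / 4) * t) ^+ 2.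
    by rewrite expr2 -expRD; congr expR; field.
  by rewrite -exprMn ler_pXn2r ?nnegrE ?mulr_ge0 ?expR_ge0 // sqrtr_ge0.
rewrite (eqH_chain_form rho K _ _ (SU 0 (lexx _)) HU0 U00) => Dt.
have [h1 _] := bnd _ (SU t (ltW t0)); have [_ h2] := bnd _ HU0.
rewrite normH_formN (formN_sqr inH (chain_form rho (fun=> 0)) (fun X _ => E0 X) _ HU0).
have := ler_wpM2l (expR_ge0 (- (e / 2) * t)) h2.
move: h1 Dt; rewrite chain_form_energy.
move: (chain_form rho K (U t) (U t)) (chain_form rho K U0 U0) => x y.
move: (chain_form rho (fun=> 0) U0 U0) (expR _) (energy _ _) => z k E g1 g2 g3.
by apply: (@le_trans _ _ x); lra.
Qed.
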